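(* Let $k\ge 3$ be an integer. Then for all real $x\ge 2^k$ we have $$\left|S_{2^k-1}(x)-\frac{x}{6}\right|\le\frac{2^{k-2}}{3}\left(\log_2 x-k+26\right).$$ In particular, the natural density of the set $S_{2^k-1}$ in $\mathbb{N}$ exists and $$\lim_{x\to+\infty}\frac{S_{2^k-1}(x)}{x}=\frac16.$$ Moreover, there exist increasing sequences $(m_l)_{l\in\mathbb{N}},(n_l)_{l\in\mathbb{N}}\subset\mathbb{N}$ such that, as $l\to\infty$, $$S_{2^k-1}(m_l)-\frac{m_l}{6}\sim\frac{2^{k-2}}{3}\log_2 m_l,\qquad S_{2^k-1}(n_l)-\frac{n_l}{6}\sim-\frac{2^{k-2}}{3}\log_2 n_l.$$
   Context: $\mathbb{N}$ is the set of non-negative integers. For a positive integer $m$, $b_m(n)$ is the number of partitions of $n$ into powers of two where each part has one of $m$ colors, i.e. $\sum_{n\ge 0} b_m(n)x^n=\prod_{j\ge 0}(1-x^{2^j})^{-m}$. Let $S_m=\{n\in\mathbb{N}: b_m(n)\neq x^2+y^2+z^2\text{ for any }x,y,z\in\mathbb{Z}\}$, and for real $x\ge 0$ let $S_m(x)=\#(S_m\cap[0,x])$ be its counting function. $a_l\sim c_l$ means $a_l/c_l\to 1$ as $l\to\infty$. *)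

(* Defs.v *)
From HB Require Import structures.
From mathcomp Require Import all_boot all_order all_algebra.
From mathcomp Require Import finmap.
From mathcomp Require Import all_classical all_reals all_analysis.
Set Implicit Arguments.
Unset Strict Implicit.
Unset Printing Implicit Defensive.
Import Order.TTheory GRing.Theory Num.Theory.
Import numFieldNormedType.Exports.

Local Open Scope classical_set_scope.
Local Open Scope ring_scope.

(* A partition of n into powers of two coloured with m colours is encoded by
   its multiplicities: f (j, c) is the number of parts 2 ^ j of colour c.
   A part 2 ^ j <= n has j < n, and no part occurs more than n times, so the
   bounds on j and on the values of f exclude no partition. *)
Definition binpart (m n : nat) : nat :=
  #|[pred f : {ffun 'I_n * 'I_m -> 'I_n.+1} |
      (\sum_(p : 'I_n * 'I_m) f p * 2 ^ p.1)%N == n]|.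

Definition not_three_squares (m : nat) : set nat :=
  [set n | forall x y z : int,
     (binpart m n)%:Z <> x ^+ 2 + y ^+ 2 + z ^+ 2].

Definition counting_fun (R : realType) (A : set nat) (x : R) : nat :=
  #|` fset_set (A `&` [set n | n%:R <= x]) |%fset.

Definition has_natural_density (R : realType) (A : set nat) (d : R) : Prop :=
  (counting_fun A (n%:R : R))%:R / n%:R @[n --> \oo] --> d.

Definition log2 (R : realType) (x : R) : R := ln x / ln 2.

Definition asymp_equiv (R : realType) (a c : nat -> R) : Prop :=
  a l / c l @[l --> \oo] --> (1 : R).

(* Main.v *)
(** The proof has three independent ingredients.

    Modulo 32.  With B the generating function of b_1, Q = 1/B has the
    Thue-Morse signs t_n as coefficients, and for P = (1 + X)^2 + 4 X^2 one has
    (1 - X)^2 P(X) = P(X^2) mod 8, hence Q^2 P = 1 mod 8 and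
    B^(2^k - 1) = P^(2^(k-1)) Q mod 32.  For n >= 2^k this gives
    b(n) = -4 t_n mod 32 when t_h = t_(h-1), h = n / 2^k, and b(n) = 2 mod 4
    otherwise.  So only the three squares theorem for the classes 2 mod 4 and
    1 mod 4 is needed, and n is in S iff t_h = t_(h-1) and t_n = 1.

    Three squares.  Let s = e and p = j = e + 1 mod 2.  By induction on n,
    through summation over n + t^2, the number r(n) of representations
    s^2 + p^2 + j^2 = n is compared with the number G(n) of solutions of
    s^2 - p^2 - j^2 = n in the cone |p| + |j| <= |s|, which is visibly positive.
    After summation over t both sides become a multiple of a divisor sum:
    for r by Jacobi's formula for two squares and Liouville's bijections, for G
    by an elementary form of the Kronecker-Hurwitz class number relation.
    For the latter, [[s + p, j + t], [j - t, s - p]] acts on the hyperbolic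
    plane; whether its fixed point lies in the ideal quadrilateral
    |p| + |j| < |s| can be read off from the way the four edges cross their
    images, and the crossings cancel in pairs except for a boundary term.

    Counting.  Put f(H) = #{1 <= h <= H : t_h = t_(h-1)} and
    D(H) = 3 f(H) - H.  Then D(2h) = - D(h) and D(2h+1) = - D(h) - 1, so that
    D(4h+i) - D(h) is 0, -1, 1, 0 for i = 0, 1, 2, 3: D is at most logarithmic,
    and extremal along 22...2 and 11...1 in base 4. *)

Require Import Defs.
From HB Require Import structures.
From mathcomp Require Import all_boot all_order all_algebra all_field.
From mathcomp Require Import finmap.
From mathcomp Require Import all_classical all_reals all_analysis.
From mathcomp Require Import zify ring lra.
Set Implicit Arguments.
Unset Strict Implicit.
Unset Printing Implicit Defensive.
Import Order.TTheory GRing.Theory Num.Theory.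
Import numFieldNormedType.Exports.

Local Open Scope ring_scope.

Local Notation quad := (int * int * (int * int))%type.
Local Notation triple := (int * (int * int))%type.

(** * The indefinite form and the class number relation *)

(* Twice the indicator function of the cone |p| + |J| < |S|, with value 1 on its boundary. *)
Definition cone_wt (S p J : int) : int := 1 + sgz (`|S| - `|p| - `|J|).

(** With x = S + p, y = S + J and L = S + p + J, the matrix [[S + p, J + t], [J - t, S - p]], read
    as a bilinear form, takes the values x, L + t, L - t, 2 y on the basis (1, 0), (1, 1), that is,
    at the endpoints infinity and 1 of one edge of the quadrilateral with vertices infinity, 1, 0,
    -1. Hence its determinant is t^2 - L^2 + 2 x y. The value can be nonzero only if 0 < |L| <= |t|
    and x, y do not have opposite signs. The sign changes in [crossing4] give the other three
    edges. *)
Definition crossing (S t p J : int) : int :=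
  (sgz (S + p) + sgz (S + J)) *
  (2 * sgz (S + p + J) - sgz (S + p + J - t) - sgz (S + p + J + t)).

Definition crossing4 (S t p J : int) : int :=
  crossing S t p J + crossing S t p (- J) + crossing S t (- p) J + crossing S t (- p) (- J).

Local Ltac pos x := rewrite (@gtr0_sgz _ x); last by lia.
Local Ltac neg x := rewrite (@ltr0_sgz _ x); last by lia.

(** Positivity of the determinant enters through the last three, linear, implications. The four
    cases S < p, p < t, J < t <= p <= S and t <= J then determine enough signs, and the identity
    holds whatever the remaining ones are. *)
Lemma cone_wt_crossing_ordered (S t p J : int) : 0 <= t -> t <= S -> 0 <= J -> J <= p -> J < S ->
  S != p -> t != p -> t != J -> 0 < S + p -> 0 < S + J -> 0 < t + p -> 0 < t + J ->
  (S < p -> p + J < S + t) -> (t < J -> t + p < S + J) -> (J < t < p -> p + J < S + t) ->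
  4 * (cone_wt S p J + cone_wt t p J) = crossing4 S t p J + crossing4 t S p J.
Proof.
move=> t0 tS J0 Jp h d1 d3 d4 d5 d6 d7 d8 F1 F2 F3.
have E1 a b : t + a + b - S = - (S - t - a - b) by ring.
have E2 a b : t + a + b + S = S + t + a + b by ring.
have E3 a b : S + a + b - t = S - t + a + b by ring.
have E4 a b : S + a + b + t = S + t + a + b by ring.
rewrite /crossing4 /crossing /cone_wt !E1 !E2 !E3 !E4 !sgzN !opprK.
rewrite (ger0_norm t0) (ger0_norm J0) (ger0_norm (le_trans t0 tS)) (ger0_norm (le_trans J0 Jp)).
  pos (S + p). pos (S + J). pos (t + p). pos (t + J). pos (S - J).
  pos (S + p + J). pos (S + p - J). pos (t + p + J). pos (S + t + p + J). pos (S + t + p - J).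
case: (ltrP p S) F1 => pS F1; last first.
  have {}F1 : p + J < S + t by lia.
  clear F2 F3 d3 d4.
  neg (S - p). neg (t - p). pos (t - J). pos (S + t - p - J). pos (S + t - p + J).
  pos (S - t + p + J). pos (S - t + p - J). neg (S - t - p + J). neg (S - t - p - J).
  neg (S - p - J). neg (t - p - J). pos (t + p - J). lia.
  pos (S - p). pos (S - p + J).
clear F1; case: (ltrP p t) F2 F3 => pt F2 F3.
  clear F2 F3.  pos (t - p). pos (t - J). pos (t + p - J). pos (t - p + J). pos (S + t - p - J). pos (S + t - p + J).
  by move: (sgz _) (sgz _) (sgz _) (sgz _) (sgz _) (sgz _) => *; lia.
case: (ltrP J t) F2 F3 => Jt F2 F3.
  have {}F3 : p + J < S + t by lia. clear F2. 
  neg (t - p). pos (t - J). pos (t + p - J). pos (S + t - p - J). pos (S + t - p + J).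
  pos (S - t + p + J). pos (S - t + p - J). neg (t - p - J).
  by move: (sgz _) (sgz _) (sgz _) => *; lia.
  neg (t - p). neg (t - J). pos (S - t + p + J). pos (S - t + p - J).
  pos (S - t - p + J). pos (S + t - p + J). neg (t - p - J).
by move: (sgz _) (sgz _) (sgz _) => *; lia.
Qed.

Lemma cone_wtN S p J : [/\ cone_wt (- S) p J = cone_wt S p J, cone_wt S (- p) J = cone_wt S p J & cone_wt S p (- J) = cone_wt S p J].
Proof. by rewrite /cone_wt !normrN. Qed.

Lemma crossingN S t p J : crossing (- S) t p J = crossing S t (- p) (- J).
Proof.
rewrite /crossing.
have -> : - S + p + J - t = - (S - p - J + t) by ring.
have -> : - S + p + J + t = - (S - p - J - t) by ring.
have -> : - S + p + J = - (S - p - J) by ring.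
have -> : - S + p = - (S - p) by ring.
have -> : - S + J = - (S - J) by ring.
rewrite !sgzN; ring.
Qed.

Lemma crossingNt S t p J : crossing S (- t) p J = crossing S t p J.
Proof. by rewrite /crossing opprK; ring. Qed.

(** Both sides are invariant under sign changes of the variables, under exchange of S and t, and
    under exchange of p and J, which reduces the claim to 0 <= t <= S and 0 <= J <= p. *)
Lemma cone_wt_crossing (e S t p J : int) :
  (2 %| S - e)%Z -> (2 %| t - e)%Z -> (2 %| p - e - 1)%Z -> (2 %| J - e - 1)%Z ->
  0 < S ^+ 2 + t ^+ 2 - p ^+ 2 - J ^+ 2 ->
  4 * (cone_wt S p J + cone_wt t p J) = crossing4 S t p J + crossing4 t S p J.
Proof.
wlog t0 : t / 0 <= t => [hw|].
  case: (lerP 0 t) => [/hw //|t0] hS ht hp hJ hN.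
  have [<- _ _] := cone_wtN t p J; have -> : crossing4 S t p J = crossing4 S (- t) p J by rewrite /crossing4 !crossingNt.
  have -> : crossing4 t S p J = crossing4 (- t) S p J by rewrite /crossing4 !crossingN !opprK; ring.
  by apply: hw => //; rewrite ?sqrrN //; lia.
wlog S0 : S / 0 <= S => [hw|].
  case: (lerP 0 S) => [/hw //|S0] hS ht hp hJ hN.
  have [<- _ _] := cone_wtN S p J; have -> : crossing4 t S p J = crossing4 t (- S) p J by rewrite /crossing4 !crossingNt.
  have -> : crossing4 S t p J = crossing4 (- S) t p J by rewrite /crossing4 !crossingN !opprK; ring.
  by apply: hw => //; rewrite ?sqrrN //; lia.
wlog p0 : p / 0 <= p => [hw|].
  case: (lerP 0 p) => [/hw //|p0] hS ht hp hJ hN.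
  have [_ <- _] := cone_wtN S p J; have [_ <- _] := cone_wtN t p J.
  have -> : crossing4 S t p J = crossing4 S t (- p) J by rewrite /crossing4 !opprK; ring.
  have -> : crossing4 t S p J = crossing4 t S (- p) J by rewrite /crossing4 !opprK; ring.
  by apply: hw => //; rewrite ?sqrrN //; lia.
wlog J0 : J / 0 <= J => [hw|].
  case: (lerP 0 J) => [/hw //|J0] hS ht hp hJ hN.
  have [_ _ <-] := cone_wtN S p J; have [_ _ <-] := cone_wtN t p J.
  have -> : crossing4 S t p J = crossing4 S t p (- J) by rewrite /crossing4 !opprK; ring.
  have -> : crossing4 t S p J = crossing4 t S p (- J) by rewrite /crossing4 !opprK; ring.
  by apply: hw => //; rewrite ?sqrrN //; lia.
wlog tS : S t t0 S0 / t <= S => [hw|].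
  case: (lerP t S) => [tS|/ltW tS]; first exact: (hw S t t0 S0 tS).
  by move=> ? ? ? ? hN; rewrite addrC [RHS]addrC; apply: hw => //; lia.
have wtC a b c : cone_wt a b c = cone_wt a c b by rewrite /cone_wt; congr (1 + sgz _); ring.
have crC a b c d : crossing a b c d = crossing a b d c by rewrite /crossing [sgz _ + sgz _]addrC (addrAC a).
wlog Jp : p J p0 J0 / J <= p => [hw|].
  case: (lerP J p) => [Jp|/ltW Jp]; first exact: (hw p J p0 J0 Jp).
  move=> ? ? ? ? hN.
  have cr4C a b c d : crossing4 a b c d = crossing4 a b d c by rewrite /crossing4 ![crossing _ _ _ c]crC ![crossing _ _ _ (- c)]crC; ring.
  by rewrite [cone_wt S _ _]wtC [cone_wt t _ _]wtC [crossing4 S _ _ _]cr4C [crossing4 t _ _ _]cr4C; apply: hw => //; lia.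
clear wtC crC.
move=> hS ht hp hJ hN.
(* The determinant equals t^2 - L^2 + 2 x y for each edge, also with S and t exchanged. Where x and
   y have opposite signs, its positivity becomes the linear inequality L < T. *)
have lt_sqr (T L x y : int) : 0 <= T -> x <= 0 -> 0 <= y ->
    S ^+ 2 + t ^+ 2 - p ^+ 2 - J ^+ 2 = T ^+ 2 - L ^+ 2 + 2 * (x * y) -> L < T.
  move=> T0 x0 y0 E; rewrite E in hN; clear -hN T0 x0 y0.
  have : x * y <= 0 by rewrite mulr_le0_ge0.
  by move: (x * y) => z; nia.
have h : J < S by clear -t0 S0 p0 J0 tS Jp hN; nia.
(* S and t have the parity of e, p and J the opposite one, so all these sums and differences are
   odd. *)
have [d1 d2 d3] : [/\ S != p, t != p & t != J] by clear -hS ht hp hJ; split; lia.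
have [d4 d5 d6 d7] : [/\ 0 < S + p, 0 < S + J, 0 < t + p & 0 < t + J].
  by clear -hS ht hp hJ t0 S0 p0 J0; split; lia.
apply: cone_wt_crossing_ordered => //.
- move=> Sp; rewrite -ltrBlDl; apply: (lt_sqr _ _ (S - p) (S - J)); [lia..| ring].
- move=> tJ; rewrite -ltrBlDr; apply: (lt_sqr _ _ (t - J) (t + p)); [lia..| ring].
- move=> tJ; rewrite -ltrBlDr; apply: (lt_sqr _ _ (t - p) (t - J)); [lia..| ring].
Qed.

(** * Reindexing finite sums over boxes of integers *)

Lemma sum_bij (V : nmodType) (T1 T2 : eqType) (s1 : seq T1) (s2 : seq T2)
    (P1 : pred T1) (P2 : pred T2) (F1 : T1 -> V) (F2 : T2 -> V)
    (g : T1 -> T2) (h : T2 -> T1) :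
  uniq s1 -> uniq s2 ->
  (forall x, x \in s1 -> P1 x -> [/\ g x \in s2, P2 (g x), h (g x) = x & F1 x = F2 (g x)]) ->
  (forall y, y \in s2 -> P2 y -> [/\ h y \in s1, P1 (h y) & g (h y) = y]) ->
  \sum_(x <- s1 | P1 x) F1 x = \sum_(y <- s2 | P2 y) F2 y.
Proof.
move=> u1 u2 H1 H2; rewrite -big_filter -[RHS]big_filter.
have pe : perm_eq [seq y <- s2 | P2 y] [seq g x | x <- [seq x <- s1 | P1 x]].
  apply: uniq_perm; first exact: filter_uniq.
    rewrite map_inj_in_uniq ?filter_uniq // => x y; rewrite !mem_filter.
    move=> /andP[Px sx] /andP[Py sy] E.
    by have [_ _ <- _] := H1 x sx Px; have [_ _ <- _] := H1 y sy Py; rewrite E.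
  move=> y; rewrite mem_filter; apply/andP/mapP => [[Py sy]|[x]].
    have [hs Ph gh] := H2 y sy Py; by exists (h y); rewrite ?mem_filter ?Ph.
  by rewrite mem_filter => /andP[Px sx ->]; have [] := H1 x sx Px.
rewrite (perm_big _ pe) big_map; apply: eq_big_seq => x; rewrite mem_filter => /andP[Px sx].
by have [] := H1 x sx Px.
Qed.

Lemma sum_invol (V : nmodType) (T : eqType) (s : seq T) (P : pred T) (F1 F2 : T -> V) (g : T -> T) :
  uniq s ->
  (forall x, x \in s -> P x -> [/\ g x \in s, P (g x), g (g x) = x & F1 x = F2 (g x)]) ->
  \sum_(x <- s | P x) F1 x = \sum_(x <- s | P x) F2 x.
Proof. by move=> us H; apply: (sum_bij (g := g) (h := g)) => // x sx /(H x sx)[]. Qed.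

Lemma sum_antisym (T : eqType) (s : seq T) (P : pred T) (F : T -> int) (g : T -> T) :
  uniq s ->
  (forall x, x \in s -> P x -> [/\ g x \in s, P (g x), g (g x) = x & F x = - F (g x)]) ->
  \sum_(x <- s | P x) F x = 0.
Proof.
move=> us H; have : \sum_(x <- s | P x) F x = - \sum_(x <- s | P x) F x; last by lia.
by rewrite -[RHS]sumrN; apply: (sum_invol (g := g)).
Qed.

Definition zrange (K : nat) : seq int := [seq i%:Z - K%:Z | i <- iota 0 (2 * K + 1)].

Lemma mem_zrange K x : (x \in zrange K) = (`|x| <= K%:Z).
Proof.
apply/mapP/idP => [[i]|h]; first by rewrite mem_iota; lia.
by exists `|(x + K%:Z)%R|%N; [rewrite mem_iota|]; lia.
Qed.

Lemma zrange_uniq K : uniq (zrange K).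
Proof. by rewrite map_inj_uniq ?iota_uniq // => x y; lia. Qed.

Definition pairs (T1 T2 : eqType) (s1 : seq T1) (s2 : seq T2) : seq (T1 * T2) :=
  [seq (a, b) | a <- s1, b <- s2].

Lemma mem_pairs (T1 T2 : eqType) (s1 : seq T1) (s2 : seq T2) a b :
  ((a, b) \in pairs s1 s2) = (a \in s1) && (b \in s2).
Proof.
apply/allpairsP/andP => [[[x y] /= [? ? [-> ->]]]|[? ?]]; first by [].
by exists (a, b).
Qed.

Lemma pairs_uniq (T1 T2 : eqType) (s1 : seq T1) (s2 : seq T2) :
  uniq s1 -> uniq s2 -> uniq (pairs s1 s2).
Proof. by move=> u1 u2; apply: allpairs_uniq => // -[? ?] [? ?]. Qed.

Lemma sum_pairs (V : nmodType) (T1 T2 : eqType) (s1 : seq T1) (s2 : seq T2) (P : T1 -> T2 -> bool)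
    (F : T1 -> T2 -> V) :
  \sum_(a <- s1) \sum_(b <- s2 | P a b) F a b = \sum_(x <- pairs s1 s2 | P x.1 x.2) F x.1 x.2.
Proof.
rewrite [RHS]big_mkcond [RHS]big_allpairs /=; apply: eq_bigr => a _; by rewrite [LHS]big_mkcond.
Qed.

(** The indefinite equation has infinitely many solutions. They are truncated by |s|, |t| <= K, a
    condition symmetric in s and t; the width 2 K for p and j loses nothing, since p^2 + j^2 < s^2 +
    t^2 <= 2 K^2 when the determinant is positive. *)
Definition qbox (K : nat) : seq (int * int * (int * int)) :=
  pairs (pairs (zrange K) (zrange K)) (pairs (zrange (2 * K)%N) (zrange (2 * K)%N)).

Lemma mem_qbox K s t p j : ((s, t, (p, j)) \in qbox K) =
  [&& `|s| <= K%:Z, `|t| <= K%:Z, `|p| <= 2 * K%:Z & `|j| <= 2 * K%:Z].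
Proof. by rewrite !mem_pairs !mem_zrange PoszM -andbA. Qed.

Lemma qbox_uniq K : uniq (qbox K).
Proof. by rewrite !pairs_uniq ?zrange_uniq. Qed.

(** * Averaging the crossings over all solutions in the box *)

Definition parity4 (e : int) (q : int * int * (int * int)) : bool :=
  let: (s, t, (p, j)) := q in
  [&& (2 %| s - e)%Z, (2 %| t - e)%Z, (2 %| p - e - 1)%Z & (2 %| j - e - 1)%Z].

(* The matrices [[s + p, j + t], [j - t, s - p]] of determinant N. *)
Definition indef (e N : int) (q : int * int * (int * int)) : bool :=
  let: (s, t, (p, j)) := q in
  parity4 e q && (s ^+ 2 + t ^+ 2 - p ^+ 2 - j ^+ 2 == N).

Definition app4 (V : Type) (f : int -> int -> int -> int -> V) (q : int * int * (int * int)) : V :=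
  let: (s, t, (p, j)) := q in f s t p j.

(** The solutions in the box are stable under exchange of s and t and under sign changes of p and j.
    Summing [cone_wt_crossing] over them therefore gives 4 (A + A) = 4 B + 4 B. *)
Lemma sum_cone_wt_crossing K (e N : int) : 0 < N ->
  \sum_(q <- qbox K | indef e N q) app4 (fun s t p j => cone_wt s p j) q =
  \sum_(q <- qbox K | indef e N q) app4 crossing q.
Proof.
move=> N0; set A := LHS; set B := RHS.
have swap (f : int -> int -> int -> int -> int) :
    \sum_(q <- qbox K | indef e N q) app4 (fun s t p j => f t s p j) q =
    \sum_(q <- qbox K | indef e N q) app4 f q.
  pose g (q : int * int * (int * int)) := let: (s, t, (p, j)) := q in (t, s, (p, j)).
  apply: (sum_invol (g := g)) (qbox_uniq K) _.
  move=> [[s t] [p j]]; rewrite /g mem_qbox /= => /and4P[? ? ? ?] /andP[/and4P[? ? ? ?] ?].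
  by split=> //; rewrite ?mem_qbox; [apply/and4P | apply/andP; split; [apply/and4P | rewrite [t ^+ 2 + _]addrC]].
have flip (a b : bool) : \sum_(q <- qbox K | indef e N q)
    app4 (fun s t p j => crossing s t ((-1) ^+ a * p) ((-1) ^+ b * j)) q = B.
  pose g (q : int * int * (int * int)) :=
    let: (s, t, (p, j)) := q in (s, t, ((-1) ^+ a * p, (-1) ^+ b * j)).
  apply: (sum_invol (g := g)) (qbox_uniq K) _.
  move=> [[s t] [p j]]; rewrite /g mem_qbox /= => /and4P[? ? ? ?] /andP[/and4P[? ? ? ?] ?].
  split=> //; rewrite ?mem_qbox ?mulrA -?expr2 ?sqrr_sign ?mul1r //.
    by apply/and4P; split; rewrite // normrM normr_sign mul1r.
  apply/andP; rewrite !exprMn !sqrr_sign !mul1r; split=> //.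
  by apply/and4P; split=> //; case: (a) (b) => -[]; rewrite ?expr0 ?expr1; lia.
have cr4B : \sum_(q <- qbox K | indef e N q) app4 crossing4 q = 4 * B.
  have -> : 4 * B = B + B + B + B by ring.
  rewrite -{1}(flip false false) -{1}(flip false true) -{1}(flip true false) -{1}(flip true true).
  rewrite -!big_split /=; apply: eq_bigr => -[[s t] [p j]] _ /=.
  by rewrite /crossing4 !expr0 !expr1 !mul1r !mulN1r.
have E : 4 * (A + A) = 4 * B + 4 * B; last by lia.
have cr4B' : \sum_(q <- qbox K | indef e N q) app4 (fun s t p j => crossing4 t s p j) q = 4 * B.
  by rewrite swap.
rewrite -{1}cr4B -cr4B' -{2}[A](swap (fun s t p j => cone_wt s p j)) -!big_split mulr_sumr.
apply: eq_bigr => -[[s t] [p j]] /andP[/and4P[? ? ? ?] /eqP E] /=.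
by apply: (cone_wt_crossing (e := e)); rewrite // E.
Qed.

Lemma norm_le_mul (x y : int) : 0 < x * y -> `|x| <= x * y.
Proof.
move=> xy; rewrite -(gtr0_norm xy) normrM ler_peMr // -gtz0_ge1 normr_gt0.
by apply: contraTneq xy => ->; rewrite mulr0.
Qed.

(** Where |L| < |t| and x y > 0, both t^2 - L^2 and 2 x y are positive. So this region is bounded in
    terms of M, and an involution of it does not leave a large box. *)
Lemma inner_bound (t L x y M : int) : `|L| < `|t| -> 0 < x * y ->
  t ^+ 2 - L ^+ 2 + 2 * (x * y) = 2 * M ->
  [/\ `|t| <= 2 * M, `|L| <= 2 * M, `|x| <= M & `|y| <= M].
Proof.
move=> Lt xy EL.
have h : `|t| + `|L| <= `|t| ^+ 2 - `|L| ^+ 2 by nia.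
rewrite !real_normK ?num_real // in h.
have hx := norm_le_mul xy.
have hy : `|y| <= x * y by rewrite mulrC norm_le_mul // mulrC.
move: (x * y) (t ^+ 2) (L ^+ 2) EL h xy hx hy => a b c *.
by split; lia.
Qed.

(** If x y < 0 the first factor of [crossing] vanishes; if |L| > |t| the second one does. Only L = t
    and L = - t remain. *)
Lemma crossing_outer (s t p j : int) : s + p != 0 -> s + j != 0 ->
  ~~ ((`|s + p + j| < `|t|) && (0 < (s + p) * (s + j))) ->
  crossing s t p j = (if s + p + j == t then crossing s t p j else 0) +
               (if s + p + j == - t then crossing s t p j else 0).
Proof.
rewrite /crossing; move: (s + p + j) => L; move: (s + p) (s + j) => x y x0 y0 h.
have [xy|xy] := ltrP 0 (x * y); last first.
  have -> : sgz x + sgz y = 0 by clear -x0 y0 xy; nia.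
  by rewrite !mul0r !if_same.
move: h; rewrite xy andbT -leNgt => h.
have [->|Lt] := eqVneq L t.
  (* For t = 0 both conditionals apply at once, but [crossing] is then 0. *)
  have [t0|t0] := eqVneq t (- t); last by rewrite addr0.
  have -> : t = 0 by lia.
  by rewrite !(subr0, addr0, sgz0, mulr0).
rewrite add0r; case: eqVneq => // LNt.
have -> : 2 * sgz L - sgz (L - t) - sgz (L + t) = 0 by lia.
by rewrite mulr0.
Qed.

(* Only the boundary [t = L] contributes, L = s + p + j: the part [L ^ 2 < t ^ 2]
   is antisymmetric under L -> - L at fixed t, x = s + p and y = s + j. *)
Lemma sum_crossing_boundary K (e : int) (M : nat) : (6 * M <= K)%N ->
  \sum_(q <- qbox K | indef e (2 * M%:Z) q) app4 crossing q =
  2 * \sum_(q <- qbox K | indef e (2 * M%:Z) q)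
        app4 (fun s t p j => if s + p + j == t then crossing s t p j else 0) q.
Proof.
move=> KM.
pose inner (q : int * int * (int * int)) := let: (s, t, (p, j)) := q in
   (`|s + p + j| < `|t|) && (0 < (s + p) * (s + j)).
rewrite (bigID inner) /= [X in X + _](sum_antisym (g := fun q : int * int * (int * int) =>
   let: (s, t, (p, j)) := q in
   (3 * s + 2 * (p + j), t, (- 2 * s - p - 2 * j, - 2 * s - 2 * p - j)))) ?qbox_uniq // ?add0r; last first.
  move=> [[s t] [p j]]; rewrite mem_qbox /= => _ /andP[/andP[/and4P[hs ht hp hj] /eqP E] /andP[Lt xy]].
  have E1 : 3 * s + 2 * (p + j) + (- 2 * s - p - 2 * j) = s + p by ring.
  have E2 : 3 * s + 2 * (p + j) + (- 2 * s - 2 * p - j) = s + j by ring.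
  have E3 : s + p + (- 2 * s - 2 * p - j) = - (s + p + j) by ring.
  have EL : t ^+ 2 - (s + p + j) ^+ 2 + 2 * ((s + p) * (s + j)) = 2 * M%:Z by rewrite -E; ring.
  have [b1 b2 b3 b4] := inner_bound Lt xy EL.
  rewrite mem_qbox; split.
  - by clear -b1 b2 b3 b4 KM; apply/and4P; split; lia.
  - rewrite E1 E2 E3 normrN Lt xy !andbT; apply/andP; split.
      by clear -hs hp hj ht; apply/and4P; split; lia.
    by rewrite -E; apply/eqP; ring.
  - by congr (_, _, (_, _)); ring.
  - rewrite /crossing E1 E2 E3; move: (s + p + j) => L.
    have -> : - L - t = - (L + t) by ring.
    have -> : - L + t = - (L - t) by ring.
    by rewrite !sgzN; ring.
rewrite [RHS]mulr_natl mulr2n.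
pose g (q : int * int * (int * int)) := let: (s, t, (p, j)) := q in (s, - t, (p, j)).
rewrite -[X in _ = _ + X](sum_invol (g := g) (F1 := app4 (fun s t p j => if s + p + j == - t then crossing s t p j else 0)))
  ?qbox_uniq //; last first.
  move=> [[s t] [p j]]; rewrite mem_qbox /g /= => /and4P[? ? ? ?] /andP[/and4P[? ? ? ?] ?].
  split; rewrite ?mem_qbox ?normrN ?sqrrN ?opprK ?crossingNt //; first by apply/and4P.
  by apply/andP; split=> //; apply/and4P; split=> //; lia.
rewrite -big_split big_mkcondr; apply: eq_bigr => -[[s t] [p j]] /= /andP[/and4P[hs ht hp hj] _].
case: ifPn => [|/negbNE /andP[Lt _]].
  by apply: crossing_outer; clear -hs hp hj; lia.
by do 2 (case: ifPn => [/eqP h|_]; first by clear -Lt h; lia).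
Qed.

(** For s >= 0 the conditions leave s - K <= L <= K. The part |L| <= K - s cancels, and K - s < L <=
    K contains s / 2 integers of the given parity, all positive. Thus the asymmetry of the
    truncation produces a value independent of K. *)
Lemma sum_sgz_shift K (e s : int) : (2 %| s)%Z -> `|s| <= K%:Z ->
  2 * \sum_(L <- zrange K | (2 %| L - e)%Z && (`|s - L| <= K%:Z)) sgz L = s.
Proof.
wlog s0 : s / 0 <= s => [hw|].
  case: (lerP 0 s) => [/hw //|s0] d sK; have := hw (- s); rewrite normrN => /(_ _ _ sK) H.
  apply: oppr_inj; rewrite -H; [|lia..]; rewrite -mulrN -sumrN; congr (2 * _).
  apply: (sum_bij (g := -%R) (h := -%R)); rewrite ?zrange_uniq // => x; rewrite mem_zrange => xK /andP[dx hx].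
    by rewrite mem_zrange normrN opprK sgzN xK; split=> //; apply/andP; split; clear -dx hx; lia.
  by rewrite mem_zrange normrN opprK xK; split=> //; apply/andP; split; clear -dx hx; lia.
move=> d sK.
rewrite (bigID (fun L => `|L| <= K%:Z - s)) /= (sum_antisym (g := -%R)) ?zrange_uniq ?add0r //; last first.
  move=> x; rewrite mem_zrange => xK /andP[/andP[dx hx] hx'].
  by rewrite mem_zrange !normrN opprK sgzN opprK; split=> //; apply/andP; split=> //; apply/andP; split; clear -dx hx hx' s0; lia.
(* b is the least integer above K - s with the parity of e. *)
pose a : int := K%:Z - s + 1; pose b := if (2 %| a - e)%Z then a else a + 1.
have [b2 ab] : (2 %| b - e)%Z /\ K%:Z - s + 1 <= b <= K%:Z - s + 2.
  by rewrite /b /a; case: ifP; lia.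
rewrite (sum_bij (s2 := iota 0 `|s %/ 2|%Z%N) (P2 := xpredT) (F2 := fun=> 1)
   (g := fun L => `|((L - b) %/ 2)%Z|%N) (h := fun i => b + 2 * i%:Z)) ?zrange_uniq ?iota_uniq //.
- by rewrite big_const_seq count_predT size_iota iter_addr_0; lia.
- move=> x; rewrite mem_zrange => xK /andP[/andP[dx hx] hx']; rewrite mem_iota.
  by clearbody a b; split=> //; lia.
- move=> x; rewrite mem_iota mem_zrange => xK _.
  by clearbody a b; split=> //; lia.
Qed.

(* Both signs of x are counted: this is twice the sum of the divisors of M. *)
Definition sumdivz (M : nat) : int := \sum_(x <- zrange M) \sum_(y <- zrange M | x * y == M%:Z) `|x|.

(** On t = L the equation reads x y = M, with L free up to |x + y - L| <= K, and [crossing] equals 2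
    sgz x sgz L. As M is odd, x + y is even, so the sum over L is sgz x (x + y) = |x| + |y| by
    [sum_sgz_shift]. *)
Lemma sum_boundary K (e : int) (M : nat) : odd M -> (6 * M <= K)%N ->
  \sum_(q <- qbox K | indef e (2 * M%:Z) q)
        app4 (fun s t p j => if s + p + j == t then crossing s t p j else 0) q = 2 * sumdivz M.
Proof.
move=> oM KM.
have -> : 2 * sumdivz M = \sum_(z <- pairs (zrange M) (zrange M) | z.1 * z.2 == M%:Z) sgz z.1 * (z.1 + z.2).
  have sE : sumdivz M = \sum_(z <- pairs (zrange M) (zrange M) | z.1 * z.2 == M%:Z) `|z.1|.
    by rewrite /sumdivz (sum_pairs _ _ (fun x y => x * y == M%:Z)).
  have sE' : sumdivz M = \sum_(z <- pairs (zrange M) (zrange M) | z.1 * z.2 == M%:Z) `|z.2|.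
    rewrite sE; apply: (sum_invol (g := fun z => (z.2, z.1))); rewrite ?pairs_uniq ?zrange_uniq //.
    by move=> [x y]; rewrite !mem_pairs andbC mulrC.
  rewrite mulr_natl mulr2n {1}sE sE' -big_split; apply: eq_bigr => -[x y] /= /eqP E.
  have : 0 < x * y by rewrite E; lia.
  by clear -oM; nia.
have -> : \sum_(z <- pairs (zrange M) (zrange M) | z.1 * z.2 == M%:Z) sgz z.1 * (z.1 + z.2) =
  \sum_(w <- pairs (pairs (zrange M) (zrange M)) (zrange K) | (w.1.1 * w.1.2 == M%:Z) &&
     ((2 %| w.2 - e)%Z && (`|w.1.1 + w.1.2 - w.2| <= K%:Z))) 2 * (sgz w.1.1 * sgz w.2).
  have -> : \sum_(z <- pairs (zrange M) (zrange M) | z.1 * z.2 == M%:Z) sgz z.1 * (z.1 + z.2) =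
   \sum_(z <- pairs (zrange M) (zrange M)) \sum_(L <- zrange K | (z.1 * z.2 == M%:Z) &&
     ((2 %| L - e)%Z && (`|z.1 + z.2 - L| <= K%:Z))) 2 * (sgz z.1 * sgz L).
    rewrite big_mkcond; apply: eq_big_seq => -[x y]; rewrite mem_pairs !mem_zrange /= => /andP[xM yM].
    case: eqP => [E|_] /=; last by rewrite big_pred0.
    rewrite -[in LHS](@sum_sgz_shift K e (x + y)); last by clear -xM yM KM; lia.
      by rewrite -mulr_sumr -mulr_sumr; ring.
    have : odd (absz (x * y)) by rewrite E.
    by rewrite abszM oddM; clear; lia.
  by rewrite (sum_pairs _ _ (fun z L => (z.1 * z.2 == M%:Z) &&
     ((2 %| L - e)%Z && (`|z.1 + z.2 - L| <= K%:Z)))).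
rewrite (eq_bigr (fun q => if app4 (fun s t p j => s + p + j == t) q then app4 crossing q else 0)); last first.
  by move=> [[s t] [p j]].
rewrite -big_mkcondr.
apply: (sum_bij (g := fun q : int * int * (int * int) => let: (s, t, (p, j)) := q in (s + p, s + j, s + p + j))
  (h := fun w : int * int * int => let: (x, y, L) := w in (x + y - L, L, (L - y, L - x)))).
- exact: qbox_uniq.
- by rewrite !pairs_uniq ?zrange_uniq.
- move=> [[s t] [p j]]; rewrite mem_qbox /= => /and4P[sK tK pK jK].
  move=> /andP[/andP[/and4P[hs ht hp hj] /eqP E] /eqP Lt].
  have xy : (s + p) * (s + j) = M%:Z.
    have : 2 * ((s + p) * (s + j)) = 2 * M%:Z by rewrite -E -Lt; ring.
    by lia.
  have xM : `|s + p| <= M%:Z by rewrite -xy norm_le_mul // xy; lia.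
  have yM : `|s + j| <= M%:Z by rewrite -xy mulrC norm_le_mul // mulrC xy; lia.
  split.
  + by rewrite !mem_pairs !mem_zrange xM yM /= Lt.
  + rewrite /= xy eqxx /=; apply/andP; split; first by clear -ht Lt; lia.
    by have -> : s + p + (s + j) - (s + p + j) = s by ring.
  + by rewrite /= Lt; congr (_, _, (_, _)); rewrite -Lt; ring.
  + rewrite /crossing Lt /= subrr sgz0 subr0.
    have -> : sgz (t + t) = sgz t by clear; lia.
    have -> : sgz (s + j) = sgz (s + p).
      have : sgz (s + p) * sgz (s + j) = 1 by rewrite -sgzM xy gtr0_sgz //; lia.
      by case: (sgzP (s + p)); case: (sgzP (s + j)).
    by ring.
- move=> [[x y] L]; rewrite !mem_pairs !mem_zrange /= => /andP[/andP[xM yM] LK].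
  move=> /andP[/eqP xy /andP[Le xyL]].
  have [ox oy] : odd (absz x) /\ odd (absz y).
    by apply/andP; rewrite -oddM -abszM xy.
  split.
  + by rewrite /= PoszM -andbA; clear -KM xM yM LK xyL; apply/and4P; split; lia.
  + rewrite /= -andbA; apply/and3P; split.
    * by clear -ox oy Le; apply/and4P; split; lia.
    * by rewrite -xy; apply/eqP; ring.
    * by apply/eqP; ring.
  + by congr (_, _, _); ring.
Qed.

Lemma sum_cone_wt K (e : int) (M : nat) : odd M -> (6 * M <= K)%N ->
  \sum_(q <- qbox K | indef e (2 * M%:Z) q) app4 (fun s t p j => cone_wt s p j) q = 4 * sumdivz M.
Proof.
by move=> oM KM; rewrite sum_cone_wt_crossing ?sum_crossing_boundary ?sum_boundary //; lia.
Qed.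

(** * Sums of two and of four squares *)

Definition chi (a : int) : int :=
  if (a %% 4)%Z == 1 then 1 else if (a %% 4)%Z == 3 then -1 else 0.

Definition alt_sign (g : int) : int := if (2 %| g)%Z then 1 else -1.

Lemma chiM a b : chi (a * b) = chi a * chi b.
Proof.
rewrite /chi -modzMm.
have : (a %% 4)%Z \in [:: 0; 1; 2; 3] by rewrite !inE; lia.
have : (b %% 4)%Z \in [:: 0; 1; 2; 3] by rewrite !inE; lia.
by rewrite !inE => /or4P[] /eqP -> /or4P[] /eqP ->.
Qed.

Lemma chi_shift (b g : int) : ~~ (2 %| b)%Z -> chi (b + 2 * g) * chi b = alt_sign g.
Proof.
rewrite /chi /alt_sign => ob.
have : (b %% 4)%Z \in [:: 1; 3] by rewrite !inE; lia.
by rewrite !inE => /orP[] /eqP hb; rewrite hb /=; do ?case: eqP; do ?case: ifP; lia.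
Qed.

(** * Liouville's bijections *)

Definition qcube (K : nat) : seq quad := pairs (pairs (zrange K) (zrange K)) (pairs (zrange K) (zrange K)).

Lemma mem_qcube K a c b v : ((a, c, (b, v)) \in qcube K) =
  [&& `|a| <= K%:Z, `|c| <= K%:Z, `|b| <= K%:Z & `|v| <= K%:Z].
Proof. by rewrite !mem_pairs !mem_zrange -andbA. Qed.

Lemma qcube_uniq K : uniq (qcube K).
Proof. by rewrite !pairs_uniq ?zrange_uniq. Qed.

Definition oddpos (a : int) : bool := (0 < a) && ~~ (2 %| a)%Z.

Definition diag4 (N : int) (q : quad) : bool :=
  let: (a, c, (b, v)) := q in
  [&& oddpos a, oddpos c, oddpos b, oddpos v & a * c + b * v == N].

Definition half4 (M : int) (q : quad) : bool :=
  let: (g, c, (h, b)) := q in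
  [&& 0 < g, oddpos c, 0 < h, oddpos b & g * c + h * b == M].

Lemma pos_bound (g c h b M : int) : 0 < g -> 0 < c -> 0 < h -> 0 < b -> g * c + h * b = M ->
  [/\ `|g| <= M, `|c| <= M, `|h| <= M & `|b| <= M].
Proof.
move=> g0 c0 h0 b0 E; have gc : 0 < g * c by rewrite mulr_gt0.
have hb : 0 < h * b by rewrite mulr_gt0.
have := norm_le_mul gc; have := norm_le_mul hb.
rewrite [g * c]mulrC [h * b]mulrC in gc hb.
have := norm_le_mul gc; have := norm_le_mul hb; rewrite [c * g]mulrC [b * h]mulrC.
by clear -E gc hb; rewrite [c * g]mulrC [b * h]mulrC in gc hb; move: (g * c) (h * b) E gc hb => x y *; split; lia.
Qed.

Lemma half4_alt (M : nat) g c h b : odd M -> half4 M (g, c, (h, b)) -> alt_sign h = - alt_sign g.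
Proof.
move=> oM /and5P[_ /andP[_ oc] _ /andP[_ ob] /eqP E].
have : (2 %| g + h - M%:Z)%Z.
  have -> : g + h - M%:Z = g * (1 - c) + h * (1 - b) by rewrite -E; ring.
  by apply: rpredD; apply: dvdz_mull; lia.
by rewrite /alt_sign; do 2 case: ifP; lia.
Qed.

(** As c and b are odd, g + h has the parity of M, so g and h carry opposite signs. Exchanging (g,
    c) and (h, b) thus kills the full sum, and (g, c, h, b) -> (h, b + 2 g, g, c - 2 h) kills the
    part 2 h < c. The case c = 2 h cannot occur, c being odd. *)
Lemma sum_half4 (K M : nat) : odd M -> (M <= K)%N ->
  \sum_(q <- qcube K | half4 M q && app4 (fun g c h b => c < 2 * h) q) app4 (fun g c h b => alt_sign g) q = 0.
Proof.
move=> oM MK; set A := LHS.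
pose F : quad -> int := app4 (fun g c h b => alt_sign g).
have E1 : \sum_(q <- qcube K | half4 M q) F q = 0.
  apply: (sum_antisym (g := fun q : quad => (q.2, q.1))); rewrite ?qcube_uniq //.
  move=> [[g c] [h b]]; rewrite mem_qcube => /and4P[? ? ? ?] H; have := half4_alt oM H.
  rewrite /F /= => ->; rewrite opprK mem_qcube; split=> //; first by apply/and4P.
  by move: H => /and5P[? ? ? ? /eqP <-]; apply/and5P; split=> //; rewrite addrC.
have E2 : \sum_(q <- qcube K | half4 M q && app4 (fun g c h b => 2 * h < c) q) F q = 0.
  apply: (sum_antisym (g := fun q : quad => let: (g, c, (h, b)) := q in (h, b + 2 * g, (g, c - 2 * h)))).
    exact: qcube_uniq.
  move=> [[g c] [h b]] _ /andP[H /= hc]; have E := half4_alt oM H.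
  have H' : half4 M (h, b + 2 * g, (g, c - 2 * h)).
    move: H => /and5P[g0 /andP[c0 oc] h0 /andP[b0 ob] /eqP <-].
    apply/and5P; split=> //; rewrite /oddpos; [lia|lia|apply/eqP; ring].
  split=> //=.
  - move: H' => /and5P[g0 /andP[c0 oc] h0 /andP[b0 ob] /eqP E'].
    by rewrite mem_qcube; have [? ? ? ?] := pos_bound g0 c0 h0 b0 E'; apply/and4P; split; lia.
  - rewrite [X in X && _]H' /=; move: H => /and5P[g0 /andP[c0 oc] h0 /andP[b0 ob] _]; lia.
  - by congr (_, _, (_, _)); ring.
  - by rewrite /F /= E opprK.
rewrite -[A]addr0 -{1}E2; apply: etrans E1; rewrite [RHS](bigID (app4 (fun g c h b => c < 2 * h))) /=; congr (_ + _).
apply: eq_bigl => -[[g c] [h b]] /=.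
case H : [&& _, _, _, _ & _] => //=.
by move: H => /and5P[_ /andP[_ oc] _ _ _]; lia.
Qed.

(** For b < a put a = b + 2 g and c + v = 2 h. The equation becomes g c + h b = M, the character
    product becomes [alt_sign] of g, and v > 0 becomes c < 2 h, so [sum_half4] applies. The part a <
    b follows by symmetry, and only a = b contributes. *)
Lemma sum_diag4 (K M : nat) : odd M -> (2 * M <= K)%N ->
  2 * \sum_(q <- qcube K | diag4 (2 * M%:Z) q) app4 (fun a c b v => chi a * chi b) q = sumdivz M.
Proof.
move=> oM MK.
pose F : quad -> int := app4 (fun a c b v => chi a * chi b).
have E1 : \sum_(q <- qcube K | diag4 (2 * M%:Z) q && app4 (fun a c b v => b < a) q) F q = 0.
  have MK' : (M <= K)%N by lia.
  apply: etrans (sum_half4 oM MK').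
  apply: (sum_bij (g := fun q : quad => let: (a, c, (b, v)) := q in (((a - b) %/ 2)%Z, c, (((c + v) %/ 2)%Z, b)))
     (h := fun q : quad => let: (g, c, (h, b)) := q in (b + 2 * g, c, (b, 2 * h - c)))); rewrite ?qcube_uniq //.
  - move=> [[a c] [b v]] _ /andP[/and5P[/andP[a0 oa] /andP[c0 oc] /andP[b0 ob] /andP[v0 ov] /eqP E] /= ba].
    have [g gE] : exists g, a = b + 2 * g by exists ((a - b) %/ 2)%Z; clear -oa ob; lia.
    have [h hE] : exists h, v = 2 * h - c by exists ((c + v) %/ 2)%Z; clear -oc ov; lia.
    have -> : ((a - b) %/ 2)%Z = g by clear -gE; lia.
    have -> : ((c + v) %/ 2)%Z = h by clear -hE; lia.
    have g0 : 0 < g by clear -gE ba; lia.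
    have h0 : 0 < h by clear -hE c0 v0; lia.
    have E' : g * c + h * b = M%:Z.
      have : 2 * (g * c + h * b) = 2 * M%:Z by rewrite -E gE hE; ring.
      by clear; lia.
    split.
    + by rewrite mem_qcube; have [? ? ? ?] := pos_bound g0 c0 h0 b0 E'; apply/and4P; split; lia.
    + by rewrite /= /oddpos g0 c0 h0 b0 oc ob E' eqxx /=; clear -hE v0; lia.
    + by congr (_, _, (_, _)).
    + by rewrite /F /= gE chi_shift.
  - move=> [[g c] [h b]] _ /andP[/and5P[g0 /andP[c0 oc] h0 /andP[b0 ob] /eqP E] /= hc].
    have H : diag4 (2 * M%:Z) (b + 2 * g, c, (b, 2 * h - c)).
      rewrite /= /oddpos c0 b0 oc ob -E /=; apply/and3P; split; [lia|lia|].
      by apply/eqP; ring.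
    split.
    + move: H => /and5P[/andP[a0 oa] /andP[_ _] /andP[_ _] /andP[v0 ov] /eqP E'].
      by rewrite mem_qcube; have [? ? ? ?] := pos_bound a0 c0 b0 v0 E'; apply/and4P; split; lia.
    + by rewrite [X in X && _]H /=; clear -g0; lia.
    + by congr (_, _, (_, _)); clear; lia.
have E2 : \sum_(q <- qcube K | diag4 (2 * M%:Z) q && app4 (fun a c b v => a < b) q) F q = 0.
  apply: etrans E1; apply: (sum_bij (g := fun q : quad => (q.2, q.1)) (h := fun q : quad => (q.2, q.1)));
    rewrite ?qcube_uniq //.
    move=> [[a c] [b v]]; rewrite mem_qcube => /and4P[? ? ? ?] /andP[/and5P[? ? ? ? ?] ?].
    rewrite mem_qcube /=; split=> //; first by apply/and4P.
      by apply/andP; split=> //; apply/and5P; split=> //; rewrite addrC.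
    by rewrite /F /= mulrC.
  move=> [[a c] [b v]]; rewrite mem_qcube => /and4P[? ? ? ?] /andP[/and5P[? ? ? ? ?] ?].
  rewrite mem_qcube /=; split=> //; first by apply/and4P.
  by apply/andP; split=> //; apply/and5P; split=> //; rewrite addrC.
have E3 : \sum_(q <- qcube K | diag4 (2 * M%:Z) q) F q =
    \sum_(q <- qcube K | diag4 (2 * M%:Z) q && app4 (fun a c b v => a == b) q) 1.
  rewrite (bigID (app4 (fun a c b v => b < a))) /= E1 add0r.
  rewrite (bigID (app4 (fun a c b v => a < b))) /= [X in X + _ = _](_ : _ = 0) ?add0r; last first.
    apply: etrans E2; apply: eq_bigl => -[[a c] [b v]] /=.
    by case: [&& _, _, _, _ & _] => //=; case: ltrgtP.
  apply: congr_big => // -[[a c] [b v]].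
    by rewrite -andbA; congr (_ && _); rewrite /=; case: ltrgtP.
  rewrite /= =>  /andP[/andP[/and5P[/andP[a0 oa] _ /andP[b0 ob] _ _] h1] h2].
  have -> : a = b by clear -h1 h2; lia.
  rewrite /F /= /chi; have : (b %% 4)%Z \in [:: 1; 3] by rewrite !inE; clear -ob; lia.
  by rewrite !inE => /orP[] /eqP ->.
rewrite -/F E3.
(* For a = b one has c + v = 2 y with a y = M. The choices c = 2 i + 1 < 2 y are y in number, which
   yields a sum of divisors y > 0, half of [sumdivz]. *)
have -> : \sum_(q <- qcube K | diag4 (2 * M%:Z) q && app4 (fun a c b v => a == b) q) 1 =
   \sum_(w <- pairs (pairs (zrange M) (zrange M)) (iota 0 M) | (w.1.1 * w.1.2 == M%:Z) && (0 < w.1.1) && (w.2%:Z < w.1.2)) (1 : int).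
  apply: (sum_bij (g := fun q : quad => let: (a, c, (b, v)) := q in
                      (a, ((c + v) %/ 2)%Z, `|((c - 1) %/ 2)%Z|%N))
     (h := fun w : int * int * nat => let: (x, y, i) := w in (x, 2 * i%:Z + 1, (x, 2 * y - 2 * i%:Z - 1)))).
  - exact: qcube_uniq.
  - by rewrite !pairs_uniq ?zrange_uniq ?iota_uniq.
  - move=> [[a c] [b v]] _ /= /andP[/and5P[/andP[a0 oa] /andP[c0 oc] _ /andP[v0 ov] /eqP E] /eqP ba].
    subst b; have [y yE] : exists y, c + v = 2 * y by exists ((c + v) %/ 2)%Z; clear -oc ov; lia.
    have E' : a * y = M%:Z.
      have : 2 * (a * y) = 2 * M%:Z by rewrite -E -mulrDr yE; ring.
      by clear; lia.
    have -> : ((c + v) %/ 2)%Z = y by clear -yE; lia.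
    have ay : 0 < a * y by rewrite E'; clear -oM; lia.
    have := norm_le_mul ay; rewrite mulrC in ay; have := norm_le_mul ay; rewrite mulrC E' => yM aM.
    rewrite !mem_pairs !mem_zrange mem_iota aM yM eqxx a0 /=.
    by clear -yM yE c0 v0 oc ov; split; lia + congr (_, _, (_, _)); lia.
  - move=> [[x y] i]; rewrite /= mem_qcube !mem_pairs !mem_zrange mem_iota /= => /andP[/andP[xM yM] iM].
    move=> /andP[/andP[/eqP E x0] iy].
    have [ox oy] : odd (absz x) /\ odd (absz y) by apply/andP; rewrite -oddM -abszM E.
    split.
    + by clear -xM yM iM MK iy; apply/and4P; split; lia.
    + rewrite eqxx andbT /oddpos x0; apply/and5P; split; try by clear -ox iy; lia.
      by apply/eqP; rewrite -E; ring.
    + by congr (_, _, _); clear; lia.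
rewrite (_ : \sum_(w <- _ | _) 1 = \sum_(z <- pairs (zrange M) (zrange M) | (z.1 * z.2 == M%:Z) && (0 < z.1)) z.2); last first.
  rewrite -(sum_pairs _ _ (fun z i => (z.1 * z.2 == M%:Z) && (0 < z.1) && (i%:Z < z.2)) (fun _ _ => 1)).
  rewrite [RHS]big_mkcond; apply: eq_big_seq => -[x y]; rewrite mem_pairs !mem_zrange /= => /andP[xM yM].
  case: ifP => [/andP[/eqP E x0]|_] /=; last by rewrite big_pred0.
  have y0 : 0 < y by have : 0 < x * y by [rewrite E; clear -oM; lia]; rewrite pmulr_rgt0.
  rewrite (sum_bij (s2 := iota 0 `|y|%N) (P2 := xpredT) (F2 := fun=> 1) (g := id) (h := id)) ?iota_uniq //.
  - by rewrite big_const_seq count_predT size_iota iter_addr_0; clear -y0; lia.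
  - by move=> i _ iy; rewrite mem_iota; split=> //; clear -iy; lia.
  - move=> i; rewrite /= !mem_iota => iy _; rewrite ?mem_iota; clear -iy yM y0; split=> //; lia.
rewrite /sumdivz (sum_pairs _ _ (fun x y => x * y == M%:Z) (fun x y => `|x|)).
rewrite mulr_natl mulr2n [RHS](bigID (fun z => 0 < z.1)) /=; congr (_ + _).
  apply: (sum_invol (g := fun z => (z.2, z.1))); rewrite ?pairs_uniq ?zrange_uniq // => -[x y].
  rewrite !mem_pairs !mem_zrange /= => /andP[xM yM] /andP[/eqP E x0].
  have y0 : 0 < y by have : 0 < x * y by [rewrite E; clear -oM; lia]; rewrite pmulr_rgt0.
  by rewrite xM yM mulrC E eqxx y0 gtr0_norm.
have pos2 x y : x * y = M%:Z -> (0 < x) = (0 < y) /\ x != 0.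
  move=> E; have xy : 0 < x * y by rewrite E; clear -oM; lia.
  have x0 : x != 0 by apply: contraTneq xy => ->; rewrite mul0r.
  split=> //; case: (ltrgtP 0 x) x0 => // x0 _; first by rewrite -(pmulr_rgt0 _ x0) xy.
  by apply/esym/negbTE; rewrite -leNgt ltW // -(nmulr_rgt0 _ x0).
apply: (sum_bij (g := fun z => (- z.2, - z.1)) (h := fun z => (- z.2, - z.1))); rewrite ?pairs_uniq ?zrange_uniq // => -[x y].
  rewrite !mem_pairs !mem_zrange !normrN !opprK /= mulrNN => /andP[xM yM] /andP[/eqP E x0].
  have [Exy x1] := pos2 _ _ E.
  rewrite xM yM mulrC E eqxx oppr_gt0 /= -leNgt; split=> //; first by rewrite ltW // -Exy.
  by rewrite gtr0_norm // -Exy.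
rewrite !mem_pairs !mem_zrange !normrN !opprK /= mulrNN => /andP[xM yM] /andP[/eqP E x0].
have [Exy x1] := pos2 _ _ E; have [_ y1] := pos2 y x (etrans (mulrC y x) E).
rewrite xM yM mulrC E eqxx oppr_gt0 /=; split=> //.
by rewrite lt_neqAle y1 leNgt -Exy x0.
Qed.

(** * Jacobi's formula for two squares *)

Definition rho (n : nat) : int := \sum_(d <- divisors n) chi d%:Z.

Definition rhodiv (p m : nat) : int := if (p %| m)%N then rho (m %/ p) else 0.

(** The divisors of p m that do not divide m are the p d with d | m and p d not dividing m; the d
    with p d | m are the divisors of m / p. *)
Lemma rho_rec p m : prime p -> (0 < m)%N ->
  rho (p * m) = rho m + chi p * (rho m - rhodiv p m).
Proof.
move=> pp m0; have p0 := prime_gt0 pp; have pm0 : (0 < p * m)%N by rewrite muln_gt0 p0.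
rewrite /rho (bigID (fun d => (d %| m)%N)) /=; congr (_ + _).
  apply: (sum_bij (g := id) (h := id)); rewrite ?divisors_uniq // => d.
    by rewrite -!dvdn_divisors.
  by rewrite -!dvdn_divisors // => dm _; split=> //; rewrite dvdn_mull.
have -> : rhodiv p m = \sum_(d <- divisors m | (p * d %| m)%N) chi d%:Z.
  rewrite /rhodiv; case: ifPn => [/dvdnP[k mE]|pm]; last first.
    rewrite big1_seq // => d /andP[pdm _].
    by case/negP: pm; apply: dvdn_trans pdm; rewrite dvdn_mulr.
  have k0 : (0 < k)%N by move: m0; rewrite mE muln_gt0 => /andP[].
  rewrite mE mulnK // /rho.
  apply: (sum_bij (g := id) (h := id)); rewrite ?divisors_uniq // => d.
    rewrite -!dvdn_divisors ?muln_gt0 ?k0 ?p0 // => dk _.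
    by rewrite [(k * p)%N]mulnC dvdn_pmul2l // dvdn_mull.
  by rewrite -!dvdn_divisors ?muln_gt0 ?k0 ?p0 // => _; rewrite [(k * p)%N]mulnC dvdn_pmul2l.
have -> : \sum_(d <- divisors m) chi d%:Z - \sum_(d <- divisors m | (p * d %| m)%N) chi d%:Z =
  \sum_(d <- divisors m | ~~ (p * d %| m)%N) chi d%:Z.
  by rewrite (bigID (fun d => (p * d %| m)%N)) /= addrC addrK.
rewrite mulr_sumr; apply: (sum_bij (g := fun d => (d %/ p)%N) (h := fun d => (p * d)%N)); rewrite ?divisors_uniq //.
  move=> d; rewrite -!dvdn_divisors // => dpm dm.
  have pd : (p %| d)%N.
    apply: contraR dm => pd; rewrite -(@Gauss_dvdr d p) // coprime_sym prime_coprime //.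
  move: pd dpm dm => /dvdnP[k ->]; rewrite [(k * p)%N]mulnC dvdn_pmul2l // mulKn // => km pkm.
  by split=> //; rewrite PoszM chiM.
move=> d; rewrite -!dvdn_divisors // => dm pdm.
by rewrite dvdn_pmul2l // mulKn.
Qed.

Definition circ (n : nat) (z : int * int) : bool := z.1 ^+ 2 + z.2 ^+ 2 == n%:Z.

Definition r2 (n : nat) : int := \sum_(z <- pairs (zrange n) (zrange n) | circ n z) 1.

Lemma circ_bound n (x y : int) : x ^+ 2 + y ^+ 2 = n%:Z -> `|x| <= n%:Z /\ `|y| <= n%:Z.
Proof. by move=> E; split; nia. Qed.

Lemma r2E K n : (n <= K)%N -> \sum_(z <- pairs (zrange K) (zrange K) | circ n z) 1 = r2 n.
Proof.
move=> nK; apply: (sum_bij (g := id) (h := id)); rewrite ?pairs_uniq ?zrange_uniq // => -[x y].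
  by rewrite !mem_pairs !mem_zrange /circ /= => _ /eqP E; have [-> ->] := circ_bound E; rewrite E eqxx.
by rewrite !mem_pairs !mem_zrange /circ /= => /andP[? ?] /eqP E; rewrite E eqxx; split=> //; lia.
Qed.

Lemma sqr_sum_dvd (p : nat) (x y : int) : prime p -> (p %% 4)%N = 3%N ->
  (p%:Z %| x ^+ 2 + y ^+ 2)%Z -> (p%:Z %| x)%Z && (p%:Z %| y)%Z.
Proof.
move=> pp p3; rewrite !(dvdz_pcharf (pchar_Fp pp)) rmorphD /= !rmorphXn /=.
move: (x%:~R : 'F_p) (y%:~R : 'F_p) => {x y} x y xy.
have [y0|y0] := eqVneq y 0.
  by move: xy; rewrite y0 expr0n addr0 expf_eq0 andbT.
have z2 : (x / y) ^+ 2 = -1.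
  by apply/eqP; rewrite expr_div_n -subr_eq0 opprK -(divff (expf_neq0 2 y0)) -mulrDl (eqP xy) mul0r.
(* With q = p / 4 rounded down, p = 2 (2 q + 1) + 1, so z = x / y satisfies z^p = (-1)^(2 q + 1) z =
   - z, while Fermat gives z^p = z. *)
have : (x / y) ^+ (2 * (2 * (p %/ 4) + 1) + 1) = x / y.
  by rewrite -[RHS]expf_card card_Fp //; congr (_ ^+ _); lia.
move/eqP; rewrite exprD exprM z2 exprD exprM sqrrN !expr1n mul1r !expr1 mulN1r.
rewrite eq_sym -subr_eq0 opprK -mulr2n -mulr_natl mulf_eq0 => /orP[|/eqP z0].
  by rewrite -(dvdn_pcharf (pchar_Fp pp)) => /dvdn_leq; lia.
by move: z2; rewrite z0 expr0n => /esym/eqP; rewrite oppr_eq0 oner_eq0.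
Qed.

Lemma r2_scale (p m : nat) : (0 < p)%N ->
  \sum_(z <- pairs (zrange (p * m)) (zrange (p * m)) | circ (p * m) z && ((p%:Z %| z.1)%Z && (p%:Z %| z.2)%Z)) 1 =
  if (p %| m)%N then r2 (m %/ p) else 0.
Proof.
move=> p0.
have main x y : (p%:Z * x) ^+ 2 + (p%:Z * y) ^+ 2 = (p * m)%N%:Z ->
    p%:Z * (x ^+ 2 + y ^+ 2) = m%:Z.
  by move=> E; apply: (@mulfI _ p%:Z); [lia | rewrite -[RHS]PoszM -E; ring].
case: ifPn => [/dvdnP[k mE]|pm]; last first.
  rewrite big1_seq // => -[x y] /andP[/andP[/eqP /= E /andP[/dvdzP[a aE] /dvdzP[b bE]]] _].
  case/negP: pm; apply/dvdnP; exists (absz (a ^+ 2 + b ^+ 2)).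
  rewrite aE bE ![_ * p%:Z]mulrC in E.
  by have := main a b E; rewrite mulrC => /(congr1 absz); rewrite abszM.
have -> : (m %/ p)%N = k by rewrite mE mulnK.
have kpm : (k <= p * m)%N by rewrite mE mulnCA leq_pmulr // muln_gt0 p0.
rewrite -(@r2E (p * m)) //.
apply: (sum_bij (g := fun z => ((z.1 %/ p)%Z, (z.2 %/ p)%Z)) (h := fun z => (p%:Z * z.1, p%:Z * z.2)));
  rewrite ?pairs_uniq ?zrange_uniq //.
- move=> [x y]; rewrite /circ /= => _ /andP[/eqP /= E /andP[/dvdzP[a aE] /dvdzP[b bE]]].
  rewrite aE bE !mulzK ?[_ * p%:Z]mulrC in E *; [|lia..].
  have E' := main a b E; rewrite mE PoszM mulrC in E'.
  have {}E' : a ^+ 2 + b ^+ 2 = k%:Z by apply: (@mulIf _ p%:Z) => //; lia.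
  have [hx hy] := circ_bound E'.
  by rewrite mem_pairs !mem_zrange E' eqxx; split=> //; apply/andP; clear -hx hy kpm; split; lia.
- move=> [x y] _; rewrite /circ /= => /eqP E.
  have E' : (p%:Z * x) ^+ 2 + (p%:Z * y) ^+ 2 = (p * m)%N%:Z.
    by rewrite mE !PoszM -E; ring.
  have [b1 b2] := circ_bound E'.
  by rewrite mem_pairs !mem_zrange b1 b2 E' eqxx !dvdz_mulr // ![p%:Z * _]mulrC !mulzK //; lia.
Qed.

Lemma r2_rec3 (p m : nat) : prime p -> (p %% 4)%N = 3%N ->
  r2 (p * m) = if (p %| m)%N then r2 (m %/ p) else 0.
Proof.
move=> pp p3; rewrite -(r2_scale _ (prime_gt0 pp)) /r2; apply: eq_bigl => -[x y].
case: (boolP (circ _ _)) => //= /eqP /= E.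
by rewrite sqr_sum_dvd // E PoszM dvdz_mulr.
Qed.

Lemma Euclid_dvdzM (p : nat) (x y : int) : prime p ->
  (p%:Z %| x * y)%Z = (p%:Z %| x)%Z || (p%:Z %| y)%Z.
Proof. by move=> pp; rewrite !dvdzE abszM Euclid_dvdM. Qed.

Lemma sqr_sum_prime_ndvd (p : nat) (a b : int) : prime p -> a ^+ 2 + b ^+ 2 = p%:Z -> ~~ (p%:Z %| a)%Z.
Proof.
move=> pp pE; have p1 := prime_gt1 pp; apply/negP => /dvdzP[c aE].
have : (p%:Z %| b * b)%Z.
  have -> : b * b = p%:Z * (1 - p%:Z * c ^+ 2) by rewrite mulrBr mulr1 -{1}pE aE; ring.
  exact: dvdz_mulr.
rewrite Euclid_dvdzM // orbb => /dvdzP[d bE].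
have : p%:Z * (c ^+ 2 + d ^+ 2) = 1.
  by apply: (@mulIf _ p%:Z); [lia | rewrite mul1r -[RHS]pE aE bE; ring].
by move/(congr1 absz)/eqP; rewrite abszM muln_eq1 => /andP[/eqP pE1 _]; move: p1; rewrite [p]pE1.
Qed.

(** The bijection is multiplication by a + b i in the Gaussian integers. It reaches x + y i as soon
    as p | a x + b y: since (a x + b y)^2 + (a y - b x)^2 = p^2 m, p then divides a y - b x too. *)
Lemma r2_half (p m : nat) (a b : int) : prime p -> a ^+ 2 + b ^+ 2 = p%:Z ->
  \sum_(z <- pairs (zrange (p * m)) (zrange (p * m)) | circ (p * m) z && (p%:Z %| a * z.1 + b * z.2)%Z) 1 = r2 m.
Proof.
move=> pp pE; have p0 := prime_gt0 pp; rewrite -(@r2E (p * m)) ?leq_pmull //.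
have pI : injective ( *%R p%:Z) by apply: mulfI; clear -p0; lia.
apply: (sum_bij (g := fun z => (((a * z.1 + b * z.2) %/ p)%Z, ((a * z.2 - b * z.1) %/ p)%Z))
    (h := fun z => (a * z.1 - b * z.2, a * z.2 + b * z.1))); rewrite ?pairs_uniq ?zrange_uniq //.
- move=> [x y] _ /andP[/eqP /= E /dvdzP[u uE]].
  have [v vE] : exists v, a * y - b * x = v * p%:Z.
    apply/dvdzP; rewrite -[X in is_true X]orbb -Euclid_dvdzM //.
    have -> : (a * y - b * x) * (a * y - b * x) = p%:Z * ((p * m)%N%:Z - p%:Z * u ^+ 2).
      have -> : p%:Z * ((p * m)%N%:Z - p%:Z * u ^+ 2) = p%:Z * (p * m)%N%:Z - (u * p%:Z) ^+ 2 by ring.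
      by rewrite -uE -E -[in RHS]pE; ring.
    exact: dvdz_mulr.
  have xE : a * u - b * v = x.
    apply: pI; have -> : p%:Z * (a * u - b * v) = a * (u * p%:Z) - b * (v * p%:Z) by ring.
    by rewrite -uE -vE -pE; ring.
  have yE : a * v + b * u = y.
    apply: pI; have -> : p%:Z * (a * v + b * u) = a * (v * p%:Z) + b * (u * p%:Z) by ring.
    by rewrite -uE -vE -pE; ring.
  have uvE : u ^+ 2 + v ^+ 2 = m%:Z.
    by apply: pI; rewrite -PoszM -E -xE -yE -[in LHS]pE; ring.
  have [hx hy] := circ_bound uvE.
  rewrite uE vE !mulzK; [|clear -p0; lia..].
  rewrite mem_pairs !mem_zrange /circ /= xE yE uvE eqxx; split=> //; have mpm : (m <= p * m)%N by rewrite leq_pmull.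
  by apply/andP; clear -mpm hx hy; split; lia.
- move=> [u v] _ /eqP /= uvE.
  have E : (a * u - b * v) ^+ 2 + (a * v + b * u) ^+ 2 = (p * m)%N%:Z.
    by rewrite PoszM -uvE -pE; ring.
  have [b1 b2] := circ_bound E.
  have uE : a * (a * u - b * v) + b * (a * v + b * u) = u * p%:Z by rewrite -pE; ring.
  have vE : a * (a * v + b * u) - b * (a * u - b * v) = v * p%:Z by rewrite -pE; ring.
  rewrite mem_pairs !mem_zrange /circ /= b1 b2 E uE vE eqxx dvdz_mull // !mulzK //; clear -p0; lia.
Qed.

(** Inclusion and exclusion: every Gaussian integer of norm p m is divisible by a + b i or by a - b
    i, and by both exactly when p divides it. *)
Lemma r2_rec1 (p m : nat) (a b : int) : prime p -> odd p -> a ^+ 2 + b ^+ 2 = p%:Z ->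
  r2 (p * m) = 2 * r2 m - if (p %| m)%N then r2 (m %/ p) else 0.
Proof.
move=> pp op pE; have p0 := prime_gt0 pp.
have pE' : a ^+ 2 + (- b) ^+ 2 = p%:Z by rewrite sqrrN.
rewrite -r2_scale // mulr_natl mulr2n -{1}(r2_half m pp pE) -(r2_half m pp pE').
rewrite /r2 !(big_mkcond (fun z => _ && _)) [LHS]big_mkcond -big_split -sumrB /=; apply: eq_bigr => -[x y] _ /=.
case: (boolP (circ _ _)) => //= /eqP /= E.
have na := sqr_sum_prime_ndvd pp pE.
have nb : ~~ (p%:Z %| b)%Z by apply: (@sqr_sum_prime_ndvd p b a) => //; rewrite addrC.
have n2 : ~~ (p%:Z %| 2)%Z.
  by apply/negP; rewrite dvdzE => /dvdn_leq; have := prime_gt1 pp; clear -op; lia.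
have AB : (p%:Z %| a * x + b * y)%Z || (p%:Z %| a * x + - b * y)%Z.
  rewrite -Euclid_dvdzM //.
  have -> : (a * x + b * y) * (a * x + - b * y) = p%:Z * (a ^+ 2 * m%:Z - y ^+ 2).
    have -> : p%:Z * (a ^+ 2 * m%:Z - y ^+ 2) = a ^+ 2 * (p * m)%N%:Z - p%:Z * y ^+ 2 by rewrite PoszM; ring.
    by rewrite -E -pE; ring.
  exact: dvdz_mulr.
have C : ((p%:Z %| a * x + b * y)%Z && (p%:Z %| a * x + - b * y)%Z) = ((p%:Z %| x)%Z && (p%:Z %| y)%Z).
  apply/andP/andP => -[h1 h2]; last by rewrite !rpredD // dvdz_mull.
  have : (p%:Z %| 2 * (a * x))%Z.
    have -> : 2 * (a * x) = (a * x + b * y) + (a * x + - b * y) by ring.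
    exact: rpredD.
  have : (p%:Z %| 2 * (b * y))%Z.
    have -> : 2 * (b * y) = (a * x + b * y) - (a * x + - b * y) by ring.
    exact: rpredB.
  by rewrite !Euclid_dvdzM // (negbTE n2) (negbTE na) (negbTE nb).
rewrite -C; by case: (_ %| _)%Z AB; case: (_ %| _)%Z.
Qed.

Definition windmill (p : int) (w : int * int * int) : bool :=
  let: (x, y, z) := w in [&& 0 < x, 0 < y, 0 < z & x ^+ 2 + 4 * y * z == p].

Definition app3 (V : Type) (f : int -> int -> int -> V) (w : int * int * int) : V :=
  let: (x, y, z) := w in f x y z.

Definition tcube (K : nat) : seq (int * int * int) := pairs (pairs (zrange K) (zrange K)) (zrange K).

Lemma tcube_uniq K : uniq (tcube K).
Proof. by rewrite !pairs_uniq ?zrange_uniq. Qed.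

Lemma windmill_bound (p : nat) w : windmill p w -> w \in tcube p.
Proof.
case: w => -[x y] z /and4P[x0 y0 z0 /eqP E]; rewrite !mem_pairs !mem_zrange.
have yz : 0 < y * z by rewrite mulr_gt0.
have h1 := norm_le_mul yz; rewrite mulrC in yz; have h2 := norm_le_mul yz; rewrite [z * y]mulrC in yz h2.
have x2 : x <= x ^+ 2 by rewrite expr2 ler_peMr; lia.
by rewrite -mulrA in E; clear -E x2 h1 h2 yz x0; apply/andP; split; [apply/andP; split|]; lia.
Qed.

Lemma sum_windmill (p : nat) (P1 P2 : pred (int * int * int)) (g h : int * int * int -> int * int * int) :
  (forall w, windmill p w -> P1 w -> [/\ windmill p (g w), P2 (g w) & h (g w) = w]) ->
  (forall w, windmill p w -> P2 w -> [/\ windmill p (h w), P1 (h w) & g (h w) = w]) ->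
  \sum_(w <- tcube p | windmill p w && P1 w) (1 : int) = \sum_(w <- tcube p | windmill p w && P2 w) 1.
Proof.
move=> H1 H2; apply: (sum_bij (g := g) (h := h)); rewrite ?tcube_uniq // => w _ /andP[wp Pw].
  by have [a b c] := H1 w wp Pw; rewrite windmill_bound // a b.
by have [a b c] := H2 w wp Pw; rewrite windmill_bound // a b.
Qed.

Lemma prime_mulz (p : nat) (u v : int) : prime p -> 0 < u -> 0 < v -> u * v = p%:Z -> u = 1 \/ v = 1.
Proof.
move=> pp u0 v0 /(congr1 absz); rewrite abszM /= => E.
have /primeP[p1 /(_ (absz u))] := pp.
have up : (absz u %| p)%N by rewrite -E dvdn_mulr.
move=> /(_ up) /orP[/eqP|/eqP uE]; [by left; lia | right].
by move: E; rewrite uE => /eqP; rewrite -{2}[p]muln1 eqn_pmul2l ?prime_gt0 //; lia.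
Qed.

(* Heath-Brown and Zagier: exchanging the regions x < y - z and 2 y < x, and
   reflecting y - z < x < 2 y in x = y, leaves only the windmills with x = y, of which
   there is one; so their number is odd and exchanging y and z fixes one of them. *)
Lemma prime1_sum2 (p : nat) : prime p -> (p %% 4)%N = 1%N -> exists a b : int, a ^+ 2 + b ^+ 2 = p%:Z.
Proof.
move=> pp p1; have op : odd p by lia.
pose N P := \sum_(w <- tcube p | windmill p w && app3 P w) (1 : int).
have eqN P Q : (forall x y z, windmill p (x, y, z) -> P x y z = Q x y z) -> N P = N Q.
  move=> PQ; apply: eq_bigl => -[[x y] z]; case w : (windmill _ _) => //=; exact: PQ.
have splitN Q P : N P = N (fun x y z => P x y z && Q x y z) + N (fun x y z => P x y z && ~~ Q x y z).
  by rewrite /N (bigID (app3 Q)) /=; congr (_ + _); apply: eq_bigl => -[[x y] z]; rewrite -andbA.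
have x_yz x y z : windmill p (x, y, z) -> x != y - z.
  move=> /and4P[x0 y0 z0 /eqP E]; apply/eqP => xE.
  have E' : (y + z) * (y + z) = p%:Z by rewrite -E xE; ring.
  by case: (prime_mulz pp _ _ E'); lia.
have x_2y x y z : windmill p (x, y, z) -> x != 2 * y.
  move=> /and4P[x0 y0 z0 /eqP E]; apply/eqP => xE.
  have E' : 4 * (y * (y + z)) = p%:Z by rewrite -E xE; ring.
  by move: (y * _) E' => u; lia.
have fix1 : N (fun x y z => x == y) = 1.
  rewrite /N (sum_bij (s2 := [:: (1, 1, ((p - 1) %/ 4)%N%:Z)]) (P2 := xpredT) (F2 := fun=> 1) (g := id) (h := id))
    ?tcube_uniq //; first by rewrite big_seq1.
  - move=> [[x y] z] _ /andP[/and4P[x0 y0 z0 /eqP E] /eqP xy]; subst y.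
    have E' : x * (x + 4 * z) = p%:Z by rewrite -E; ring.
    have x1 : x = 1 by case: (prime_mulz pp _ _ E'); lia.
    by split=> //; rewrite inE x1; apply/eqP; congr (_, _, _); move: E'; rewrite x1; lia.
  - move=> w; rewrite inE => /eqP -> _.
    have w0 : windmill p (1, 1, ((p - 1) %/ 4)%N%:Z) by have := prime_gt1 pp; rewrite /=; lia.
    by split=> //; [exact: windmill_bound | rewrite w0].
have mid : N (fun x y z => (y - z < x < 2 * y) && (x < y)) = N (fun x y z => (y - z < x < 2 * y) && (y < x)).
  apply: (@sum_windmill p _ _ (app3 (fun x y z => (2 * y - x, y, x - y + z)))
                              (app3 (fun x y z => (2 * y - x, y, x - y + z)))) => -[[x y] z] /=.
    move=> /and4P[x0 y0 z0 /eqP E] /andP[/andP[h1 h2] h3]; split; [|lia|by congr (_, _, _); ring].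
    by apply/and4P; split; [lia..|rewrite -E; apply/eqP; ring].
  move=> /and4P[x0 y0 z0 /eqP E] /andP[/andP[h1 h2] h3]; split; [|lia|by congr (_, _, _); ring].
  by apply/and4P; split; [lia..|rewrite -E; apply/eqP; ring].
have out : N (fun x y z => x < y - z) = N (fun x y z => 2 * y < x).
  apply: (@sum_windmill p _ _ (app3 (fun x y z => (x + 2 * z, z, y - x - z)))
                              (app3 (fun x y z => (x - 2 * y, x - y + z, y)))) => -[[x y] z] /=.
    move=> /and4P[x0 y0 z0 /eqP E] h; split; [|lia|by congr (_, _, _); ring].
    by apply/and4P; split; [lia..|rewrite -E; apply/eqP; ring].
  move=> /and4P[x0 y0 z0 /eqP E] h; split; [|lia|by congr (_, _, _); ring].
  by apply/and4P; split; [lia..|rewrite -E; apply/eqP; ring].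
have swap : N (fun x y z => y < z) = N (fun x y z => z < y).
  apply: (@sum_windmill p _ _ (app3 (fun x y z => (x, z, y))) (app3 (fun x y z => (x, z, y)))) => -[[x y] z] /=.
    by move=> /and4P[x0 y0 z0 /eqP E] h; split=> //; apply/and4P; split=> //; rewrite -E; apply/eqP; ring.
  by move=> /and4P[x0 y0 z0 /eqP E] h; split=> //; apply/and4P; split=> //; rewrite -E; apply/eqP; ring.
have T1 : N (fun _ _ _ => true) = 2 * N (fun x y z => 2 * y < x) +
    (2 * N (fun x y z => (y - z < x < 2 * y) && (y < x)) + N (fun x y z => x == y)).
  rewrite (splitN (fun x y z => x < y - z)) (splitN (fun x y z => 2 * y < x) (fun x y z => _ && ~~ _)).
  rewrite (splitN (fun x y z => x < y) (fun x y z => _ && ~~ (2 * y < x))).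
  rewrite (splitN (fun x y z => x == y) (fun x y z => _ && ~~ (x < y))) !mulr_natl !mulr2n -{1}out -{1}mid -!addrA.
  have aux P Q : (forall x y z : int, 0 < x -> 0 < y -> 0 < z -> x != y - z -> x != 2 * y -> P x y z = Q x y z) ->
      N P = N Q.
    move=> PQ; apply: eqN => x y z w; have := x_yz x y z w; have := x_2y x y z w.
    by move: w => /and4P[? ? ? _] ? ?; apply: PQ.
  rewrite [X in _ + (_ + (_ + X)) = _]addrC.
  congr (_ + _).
  congr (_ + _); first by apply: aux; lia.
  congr (_ + _); first by apply: aux; lia.
  by congr (_ + _); apply: aux; lia.
have T2 : N (fun _ _ _ => true) = 2 * N (fun x y z => y < z) + N (fun x y z => y == z).
  rewrite (splitN (fun x y z => y < z)) [X in _ + X](splitN (fun x y z => y == z)).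
  rewrite mulr_natl mulr2n [in RHS]swap -{1}swap -addrA [X in _ + X = _]addrC.
  congr (_ + (_ + _)); apply: eqN => x y z _; lia.
have : N (fun x y z => y == z) != 0 by apply/eqP => E; move: T1; rewrite T2 E fix1; lia.
rewrite /N => h.
have /hasP[[[x y] z] _ /andP[/and4P[_ _ _ /eqP E] /eqP yz]] :
    has (fun w => windmill p w && app3 (fun x y z => y == z) w) (tcube p).
  apply: contraNT h => /hasPn h; rewrite big1_seq // => w /andP[wP /h].
  by rewrite wP.
by exists x, (2 * y); rewrite -E -yz; ring.
Qed.

(** Both sides obey the same recursion at every odd prime p: [rho_rec] becomes [r2_rec1] for chi p =
    1 and [r2_rec3] for chi p = -1. *)
Lemma r2_rho n : odd n -> r2 n = 4 * rho n.
Proof.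
elim/ltn_ind: n => n IH on.
have n0 : (0 < n)%N by case: n on {IH}.
have [n1|n1] := leqP n 1.
  have -> : n = 1%N by apply/eqP; rewrite eqn_leq n1 n0.
  by rewrite /r2 /rho unlock.
have pp := pdiv_prime n1; have [m nE] := dvdnP (pdiv_dvd n).
move: (pdiv n) pp nE => p pp nE; rewrite mulnC in nE.
have [op om] : odd p /\ odd m by apply/andP; rewrite -oddM -nE.
have m0 : (0 < m)%N by case: (m) om.
have mn : (m < n)%N by rewrite nE ltn_Pmull // prime_gt1.
have IHdiv : (if (p %| m)%N then r2 (m %/ p) else 0) = 4 * rhodiv p m.
  rewrite /rhodiv; case: ifP => [pm|]; last by rewrite mulr0.
  rewrite IH //; first by apply: leq_ltn_trans mn; apply: leq_div.
  by move: om; rewrite -{1}(divnK pm) oddM => /andP[].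
rewrite nE rho_rec //; have [p1|p3] : (p %% 4 = 1)%N \/ (p %% 4 = 3)%N by lia.
  have [a [b pE]] := prime1_sum2 pp p1.
  have -> : chi p = 1 by rewrite /chi; have -> : (p %% 4)%Z = 1 by lia.
  by rewrite (r2_rec1 m pp op pE) IHdiv IH //; ring.
have -> : chi p = -1 by rewrite /chi; have -> : (p %% 4)%Z = 3 by lia.
by rewrite r2_rec3 // IHdiv; ring.
Qed.

(** * From two squares to four by convolution *)

Lemma sum_conv (T : eqType) (s : seq T) (P : pred T) (f w : T -> int) (N : nat) :
  (forall x, P x -> 0 <= f x) ->
  \sum_(q <- pairs s s | [&& P q.1, P q.2 & f q.1 + f q.2 == N%:Z]) w q.1 * w q.2 =
  \sum_(m <- iota 0 N.+1) (\sum_(x <- s | P x && (f x == m%:Z)) w x) *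
                          (\sum_(x <- s | P x && (f x == (N - m)%N%:Z)) w x).
Proof.
move=> f0; have mr m : (m \in iota 0 N.+1) = (m <= N)%N by rewrite mem_iota.
have := iota_uniq 0 N.+1; move: (iota 0 N.+1) mr => r mr ur; rewrite -(sum_pairs _ _ (fun x y => [&& P x, P y & f x + f y == N%:Z]) (fun x y => w x * w y)).
under [RHS]eq_bigr do rewrite mulr_suml big_mkcond.
rewrite exchange_big /=; apply: eq_bigr => x _.
case: (boolP (P x)) => Px; last by rewrite !big1 ?big_pred0.
rewrite /= -[RHS]big_mkcond.
have fx := f0 x Px; have [fN|fN] := lerP (f x) N%:Z; last first.
  rewrite big1_seq => [|y /andP[/andP[Py /eqP E] _]]; last by have := f0 y Py; lia.
  by rewrite big1_seq // => m /andP[/eqP E]; rewrite mr; lia.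
rewrite big_mkcond (bigD1_seq `|f x|%N) ?mr //=; [|lia..].
rewrite [X in _ = _ + X]big1 ?addr0; last by move=> m mf; case: eqP => // E; lia.
rewrite ifT; last lia; rewrite mulr_sumr; apply: eq_bigl => y.
by case: (P y) => //=; lia.
Qed.

Definition oddpos2 (z : int * int) : bool := oddpos z.1 && oddpos z.2.

Definition parity2 (e : int) (z : int * int) : bool := (2 %| z.1 - e)%Z && (2 %| z.2 - e - 1)%Z.

Lemma sqr_parity (x : int) : (2 %| x ^+ 2 - x)%Z.
Proof.
have [k [->|->]] : exists k, x = 2 * k \/ x = 2 * k + 1 by exists (x %/ 2)%Z; lia.
  have -> : (2 * k) ^+ 2 - 2 * k = 2 * (2 * k ^+ 2 - k) by ring.
  exact: dvdz_mulr.
have -> : (2 * k + 1) ^+ 2 - (2 * k + 1) = 2 * (2 * k ^+ 2 + k) by ring.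
exact: dvdz_mulr.
Qed.

Lemma sum_oddpos2 K (m : nat) : (m <= K)%N ->
  \sum_(z <- pairs (zrange K) (zrange K) | oddpos2 z && (z.1 * z.2 == m%:Z)) chi z.1 =
  if odd m then rho m else 0.
Proof.
move=> mK; case: ifPn => om; last first.
  rewrite big1_seq // => -[x y] /andP[/andP[/andP[/andP[_ /= ox] /andP[_ oy]] /eqP E] _].
  have : odd (absz (x * y)) by rewrite abszM oddM; lia.
  by rewrite E (negPf om).
have m0 : (0 < m)%N by case: (m) om.
rewrite /rho; apply: (sum_bij (g := fun z => absz z.1) (h := fun d => (d%:Z, (m %/ d)%N%:Z)));
  rewrite ?pairs_uniq ?zrange_uniq ?divisors_uniq //.
  move=> [x y] _ /andP[/andP[/andP[/= x0 _] /andP[/= y0 _]] /eqP /= E].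
  have xE : `|x|%N%:Z = x by lia.
  have yE : `|y|%N%:Z = y by lia.
  have mE : (absz x * absz y)%N = m by rewrite -abszM E.
  rewrite -dvdn_divisors // -{1}mE dvdn_mulr //= xE; split=> //.
  by rewrite -mE mulKn ?yE //; lia.
move=> d; rewrite -dvdn_divisors // => dm _; have := divnK dm; rewrite mem_pairs !mem_zrange /oddpos2 /oddpos.
move: (m %/ d)%N => k mE.
have [ok od] : odd k /\ odd d by apply/andP; rewrite -oddM mE.
have [kK dK] : (k <= K)%N /\ (d <= K)%N.
  by split; apply: leq_trans mK; rewrite -mE ?leq_pmulr ?leq_pmull //; [case: (d) od|case: (k) ok].
by rewrite /= -mE PoszM mulrC eqxx; split=> //; clear -ok od kK dK; lia.
Qed.

(** In a representation of an odd m exactly one coordinate has the parity of e, so exchanging the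
    coordinates shows that half of the 4 [rho] m representations qualify. *)
Lemma sum_parity2 K (e : int) (m : nat) : (m <= K)%N ->
  \sum_(z <- pairs (zrange K) (zrange K) | parity2 e z && (z.1 ^+ 2 + z.2 ^+ 2 == m%:Z)) 1 =
  2 * if odd m then rho m else 0.
Proof.
move=> mK; case: ifPn => om; last first.
  rewrite big1_seq // => -[x y] /andP[/andP[/andP[/= ox oy] /eqP E] _].
  by have := sqr_parity x; have := sqr_parity y; lia.
suff : 2 * \sum_(z <- pairs (zrange K) (zrange K) | parity2 e z && (z.1 ^+ 2 + z.2 ^+ 2 == m%:Z)) 1 = r2 m.
  by rewrite r2_rho //; lia.
rewrite -(r2E mK) [RHS](bigID (parity2 e)) /= mulr_natl mulr2n; congr (_ + _).
  by apply: eq_bigl => z; rewrite andbC.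
apply: (sum_bij (g := fun z => (z.2, z.1)) (h := fun z => (z.2, z.1))); rewrite ?pairs_uniq ?zrange_uniq // => -[x y].
  rewrite !mem_pairs /circ /= => /andP[-> ->] /andP[/andP[/= h1 h2] /eqP <-]; split=> //.
  by rewrite addrC eqxx /parity2 /=; lia.
rewrite !mem_pairs /circ /= => /andP[-> ->] /andP[/eqP E h]; split=> //.
rewrite addrC E eqxx andbT; move: h; have := sqr_parity x; have := sqr_parity y; rewrite /parity2 /=; lia.
Qed.

Definition def4 (e N : int) (q : int * int * (int * int)) : bool :=
  let: (s, t, (p, j)) := q in parity4 e q && (s ^+ 2 + t ^+ 2 + p ^+ 2 + j ^+ 2 == N).

(** Grouping s with p and t with j turns the count into the convolution square, at 2 M, of m -> 2
    [rho] m supported on odd m. The sum in [sum_diag4] is the convolution square of [rho] on odd m,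
    so the count is four times that sum. *)
Lemma sum_def4 K (e : int) (M : nat) : odd M -> (2 * M <= K)%N ->
  \sum_(q <- qbox K | def4 e (2 * M%:Z) q) 1 = 2 * sumdivz M.
Proof.
move=> oM MK.
have -> : \sum_(q <- qbox K | def4 e (2 * M%:Z) q) 1 =
  \sum_(q <- pairs (pairs (zrange K) (zrange K)) (pairs (zrange K) (zrange K)) | [&& parity2 e q.1, parity2 e q.2 &
      (q.1.1 ^+ 2 + q.1.2 ^+ 2) + (q.2.1 ^+ 2 + q.2.2 ^+ 2) == (2 * M)%N%:Z]) 1 * 1 :> int.
  apply: (sum_bij (g := fun q : quad => let: (s, t, (p, j)) := q in (s, p, (t, j)))
                  (h := fun q : quad => let: (s, p, (t, j)) := q in (s, t, (p, j)))); rewrite ?qbox_uniq ?qcube_uniq //.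
    move=> [[s t] [p j]] _ /= /andP[/and4P[hs ht hp hj] /eqP E].
    rewrite !mem_pairs !mem_zrange /parity2 /= hs ht hp hj PoszM -E; split=> //; last by apply/eqP; ring.
    have b (x y : int) : 0 <= y -> x ^+ 2 + y = (2 * M)%N%:Z -> `|x| <= K%:Z.
      by clear -MK => y0 E; nia.
    have sq := @sqr_ge0 int.
    apply/andP; split; apply/andP; split.
    - by apply: (b _ (t ^+ 2 + p ^+ 2 + j ^+ 2)); rewrite ?addr_ge0 ?sq // PoszM -E; ring.
    - by apply: (b _ (t ^+ 2 + s ^+ 2 + j ^+ 2)); rewrite ?addr_ge0 ?sq // PoszM -E; ring.
    - by apply: (b _ (s ^+ 2 + p ^+ 2 + j ^+ 2)); rewrite ?addr_ge0 ?sq // PoszM -E; ring.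
    - by apply: (b _ (t ^+ 2 + p ^+ 2 + s ^+ 2)); rewrite ?addr_ge0 ?sq // PoszM -E; ring.
  move=> [[s p] [t j]]; rewrite !mem_pairs !mem_zrange /parity2 /= => /andP[/andP[h1 h2] /andP[h3 h4]].
  move=> /and3P[/andP[-> ->] /andP[-> ->] /eqP E]; split=> //.
    by rewrite h1 h3 /=; clear -h2 h4; lia.
  by rewrite -PoszM -E; apply/eqP; ring.
have f1 (z : int * int) : parity2 e z -> 0 <= z.1 ^+ 2 + z.2 ^+ 2 by rewrite addr_ge0 ?sqr_ge0.
rewrite (sum_conv _ (fun=> 1) _ f1).
have E m : (m <= 2 * M)%N -> \sum_(z <- pairs (zrange K) (zrange K) | parity2 e z && (z.1 ^+ 2 + z.2 ^+ 2 == m%:Z)) (1 : int) =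
    2 * \sum_(z <- pairs (zrange K) (zrange K) | oddpos2 z && (z.1 * z.2 == m%:Z)) chi z.1.
  by move=> mM; rewrite sum_parity2 ?sum_oddpos2 //; lia.
rewrite -(sum_diag4 oM MK).
have -> : \sum_(q <- qcube K | diag4 (2 * M%:Z) q) app4 (fun a _ b _ => chi a * chi b) q =
  \sum_(q <- pairs (pairs (zrange K) (zrange K)) (pairs (zrange K) (zrange K)) | [&& oddpos2 q.1, oddpos2 q.2 &
      q.1.1 * q.1.2 + q.2.1 * q.2.2 == (2 * M)%N%:Z]) chi q.1.1 * chi q.2.1.
  apply: congr_big => // -[[a c] [b v]]; by rewrite //= /oddpos2 /= -!andbA.
have f2 (z : int * int) : oddpos2 z -> 0 <= z.1 * z.2.
  by move=> /andP[/andP[z1 _] /andP[z2 _]]; rewrite mulr_ge0 // ltW.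
rewrite (sum_conv _ (fun z => chi z.1) _ f2) !mulr_sumr; apply: eq_big_seq => m; rewrite mem_iota => mM.
rewrite !E; [by ring | lia..].
Qed.

(** * Three squares *)

Definition parity3 (e : int) (w : triple) : bool :=
  let: (s, (p, j)) := w in [&& (2 %| s - e)%Z, (2 %| p - e - 1)%Z & (2 %| j - e - 1)%Z].

Definition sum3 (K : nat) (e : int) (phi F : int -> int -> int -> int) (n : int) : int :=
  \sum_(w <- pairs (zrange K) (pairs (zrange (2 * K)%N) (zrange (2 * K)%N)) | parity3 e w && (phi w.1 w.2.1 w.2.2 == n))
    F w.1 w.2.1 w.2.2.

(** The variable t enters both quaternary forms as + t^2, so both quaternary sums become sums over t
    of ternary ones at N - t^2. *)
Lemma sum4_sum3 K e phi F N :
  \sum_(q <- qbox K | app4 (fun s t p j => parity4 e (s, t, (p, j)) && (phi s p j + t ^+ 2 == N)) q)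
    app4 (fun s t p j => F s p j) q =
  \sum_(t <- zrange K | (2 %| t - e)%Z) sum3 K e phi F (N - t ^+ 2).
Proof.
set box := pairs (zrange (2 * K)%N) (zrange (2 * K)%N).
transitivity (\sum_(u <- pairs (zrange K) (pairs (zrange K) box) |
    (2 %| u.1 - e)%Z && (parity3 e u.2 && (phi u.2.1 u.2.2.1 u.2.2.2 == N - u.1 ^+ 2))) F u.2.1 u.2.2.1 u.2.2.2).
  apply: (sum_bij (g := fun q : quad => let: (s, t, (p, j)) := q in (t, (s, (p, j))))
                  (h := fun u : int * triple => let: (t, (s, (p, j))) := u in (s, t, (p, j))));
    rewrite ?qbox_uniq ?pairs_uniq ?zrange_uniq //.
    move=> [[s t] [p j]]; rewrite !mem_pairs => /= /andP[/andP[-> ->] ->] /andP[/and4P[-> -> -> ->] /eqP <-].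
    by rewrite addrK eqxx.
  move=> [t [s [p j]]]; rewrite !mem_pairs /= => /and3P[-> -> ->] /andP[-> /andP[/and3P[-> -> ->] /eqP ->]].
  by rewrite subrK eqxx.
rewrite -(sum_pairs _ _ (fun t w => (2 %| t - e)%Z && (parity3 e w && (phi w.1 w.2.1 w.2.2 == N - t ^+ 2)))
   (fun t w => F w.1 w.2.1 w.2.2)) [RHS]big_mkcond; apply: eq_bigr => t _.
by case: (2 %| t - e)%Z => //=; rewrite big_pred0.
Qed.

Definition def_form (s p j : int) : int := s ^+ 2 + p ^+ 2 + j ^+ 2.

Definition indef_form (s p j : int) : int := s ^+ 2 - p ^+ 2 - j ^+ 2.

(** The factor 2 matches [cone_wt], which is twice an indicator function inside the cone. *)
Definition defect3 K e n : int := 2 * sum3 K e def_form (fun _ _ _ => 1) n - sum3 K e indef_form cone_wt n.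

Lemma sum_defect3 K e M : odd M -> (6 * M <= K)%N ->
  \sum_(t <- zrange K | (2 %| t - e)%Z) defect3 K e (2 * M%:Z - t ^+ 2) = 0.
Proof.
move=> oM MK; rewrite /defect3 sumrB -mulr_sumr -!sum4_sum3; apply/eqP; rewrite subr_eq0; apply/eqP.
transitivity (2 * (2 * sumdivz M)).
  congr (2 * _); rewrite -(@sum_def4 K e M) //; last by lia.
  by apply: congr_big => // -[[s t] [p j]] //=; rewrite /def_form; congr (_ && (_ == _)); ring.
transitivity (4 * sumdivz M); first by ring.
rewrite -(@sum_cone_wt K e M) //.
by apply: congr_big => // -[[s t] [p j]] //=; rewrite /indef_form; congr (_ && (_ == _)); ring.
Qed.

Lemma cone_wt_ge0 s p j : 0 <= cone_wt s p j.
Proof. by rewrite /cone_wt; case: sgzP. Qed.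

(** In the closed cone s^2 - p^2 - j^2 >= 2 |p j|; if p or j is 0, then |s| differs from the
    absolute value of the other by parity. So the indefinite form is positive there. The definite
    form could reach n <= 0 only with s = p = 0, again against parity. *)
Lemma defect3_neg K e n : n <= 0 -> defect3 K e n = 0.
Proof.
move=> n0; rewrite /defect3 /sum3 !big1_seq ?mulr0 ?subr0 // => -[s [p j]] /andP[/andP[/and3P[hs hp hj] /eqP /= E] _].
  rewrite /cone_wt ltr0_sgz ?subrr //; rewrite ltNge; apply/negP => h; rewrite /indef_form in E.
  have sq (x : int) : x ^+ 2 = `|x| ^+ 2 by rewrite real_normK ?num_real.
  rewrite (sq s) (sq p) (sq j) in E; have [pj|pj] : (p = 0 \/ j = 0) \/ (0 < `|p| /\ 0 < `|j|) by lia.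
    by case: pj => E0; rewrite E0 normr0 in E h; [have : `|s| != `|j| by lia | have : `|s| != `|p| by lia];
      move: (normr_ge0 s) (normr_ge0 p) (normr_ge0 j) h E; move: `|s| `|p| `|j| => a b c; clear -n0; nia.
  by move: pj h E; move: `|s| `|p| `|j| => a b c; clear -n0; nia.
rewrite /def_form in E; have [s0 p0] : s = 0 /\ p = 0 by clear -E n0; split; nia.
by rewrite s0 p0 in hs hp; lia.
Qed.

(** Take 2 M = n + e in [sum_defect3]. The terms |t| = e sit at n itself. Any other t of the parity
    of e has t^2 - e a positive multiple of 4, so its argument is smaller and in the same class
    modulo 4: it falls under the induction hypothesis or [defect3_neg]. *)
Lemma defect3_eq0 K (e : bool) n : (6 * n.+1 <= K)%N -> (n %% 4 = if e then 1 else 2)%N -> defect3 K e%:Z n%:Z = 0.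
Proof.
elim/ltn_ind: n => n IH nK en.
have [M [oM ME]] : exists M, odd M /\ (2 * M = n + e)%N.
  by exists ((n + e) %/ 2)%N; move: en; case: (e); lia.
have MK : (6 * M <= K)%N by lia.
have := sum_defect3 e%:Z oM MK.
have small t : t \in zrange K -> (2 %| t - e%:Z)%Z -> `|t| != e%:Z -> defect3 K e%:Z (2 * M%:Z - t ^+ 2) = 0.
  move=> tK te tne; have [h|h] := lerP (2 * M%:Z - t ^+ 2) 0; first exact: defect3_neg.
  have [k kE] : exists k : int, t = 2 * k + e%:Z by exists ((t - e%:Z) %/ 2)%Z; lia.
  have tE : t ^+ 2 = 4 * (k ^+ 2 + k * e%:Z) + e%:Z by rewrite kE; case: (e) => /=; ring.
  have k0 : 0 < k ^+ 2 + k * e%:Z by clear -kE tne; move: kE tne; case: (e) => /=; nia.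
  rewrite tE in h *; move: (k ^+ 2 + _) k0 h => u u0 h.
  rewrite -(gez0_abs (ltW h)).
  by apply: IH; case: (e) en ME h; lia.
rewrite (bigID (fun t => `|t| == e%:Z)) /= [X in _ + X]big1_seq ?addr0; last first.
  by move=> t /andP[/andP[te tne] tK]; exact: small.
rewrite (eq_bigr (fun=> defect3 K e%:Z n%:Z)); last first.
  move=> t /andP[_ /eqP tE]; congr defect3.
  have -> : t ^+ 2 = `|t| ^+ 2 by rewrite real_normK ?num_real.
  by rewrite tE; case: (e) ME; rewrite ?expr1n ?expr0n /=; lia.
(* What is left is a multiple of the defect at n, and t = e shows that the multiplicity is not 0. *)
rewrite big_const_seq iter_addr_0 => /eqP; rewrite mulrn_eq0 => /orP[|/eqP //].
rewrite eqn0Ngt -has_count => /negP[]; apply/hasP; exists e%:Z; first by rewrite mem_zrange; lia.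
by rewrite subrr dvdz0 ger0_norm ?eqxx.
Qed.

(* Both classes share one proof: 2 r(n) = G(n) >= 1, where G counts the solutions of
   s ^ 2 - p ^ 2 - j ^ 2 = n with |p| + |j| <= |s|, e.g. j = 0 and s - p = 1. *)
Lemma three_squares n : (n %% 4 = 1)%N \/ (n %% 4 = 2)%N ->
  exists x y z : int, n%:Z = x ^+ 2 + y ^+ 2 + z ^+ 2.
Proof.
move=> n4; have [e en] : exists e : bool, (n %% 4 = if e then 1 else 2)%N.
  by case: n4 => h; [exists true | exists false].
pose K := (6 * n.+1)%N; have := defect3_eq0 (leqnn K) en; rewrite /defect3 => /eqP; rewrite subr_eq0 => /eqP.
have G0 : 0 < sum3 K e%:Z indef_form cone_wt n%:Z.
  pose s : int := (n %/ 2)%N%:Z + 1.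
  pose w : triple := if e then (s, (s - 1, 0)) else (s, (s - 1, 1)).
  have wb : w \in pairs (zrange K) (pairs (zrange (2 * K)%N) (zrange (2 * K)%N)).
    by rewrite /w /s; case: (e); rewrite !mem_pairs !mem_zrange /K; lia.
  have wpar : parity3 e%:Z w && (indef_form w.1 w.2.1 w.2.2 == n%:Z).
    rewrite /w /s /indef_form; case: (e) en => /= en; apply/andP; split; lia.
  have wt0 : 0 < cone_wt w.1 w.2.1 w.2.2 by rewrite /w /s /cone_wt; case: (e) => /=; lia.
  rewrite /sum3 big_mkcond (bigD1_seq w) //; last by rewrite !pairs_uniq ?zrange_uniq.
  rewrite wpar ltr_wpDr // sumr_ge0 // => u _; case: ifP => // _; exact: cone_wt_ge0.
move=> E; rewrite -E in G0.
have : has (fun w => parity3 e%:Z w && (def_form w.1 w.2.1 w.2.2 == n%:Z)) (pairs (zrange K) (pairs (zrange (2 * K)%N) (zrange (2 * K)%N))).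
  apply: contraLR G0 => /hasPn h; rewrite /sum3 big1_seq // => w /andP[wP /h].
  by rewrite wP.
by move=> /hasP[w _ /andP[_ /eqP <-]]; exists w.1, w.2.1, w.2.2.
Qed.

(** * Binary partitions modulo 32 *)

(* Truncations of B and Q, exact up to degree n and below degree 2 ^ n. *)
Definition Gpoly (n : nat) : {poly int} := \prod_(j < n) \sum_(i < n.+1) 'X^(i * 2 ^ j).
Definition Qpoly (n : nat) : {poly int} := \prod_(j < n) (1 - 'X^(2 ^ j)).
Definition Ppoly : {poly int} := (1 + 'X) ^+ 2 + 4 * 'X^2.

Lemma binpart_coef (m n : nat) : (binpart m n)%:Z = (Gpoly n ^+ m)`_n.
Proof.
rewrite /Gpoly -[X in _ ^+ X]card_ord -prodr_const exchange_big /= pair_big /=.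
rewrite bigA_distr_bigA coef_sum /binpart -sum1_card -natz natr_sum big_mkcond /=; apply: eq_bigr => f _.
by rewrite prodrXr coefXn eq_sym inE; case: (_ == _).
Qed.

(* Congruence modulo the ideal (a, c): a is a power of 2, c is 0 or a power of X. *)
Definition eqmodI (a c A B : {poly int}) : Prop := exists E F, A - B = a * E + c * F.

Lemma eqmodI_refl a c A : eqmodI a c A A.
Proof. by exists 0, 0; rewrite subrr !mulr0 addr0. Qed.

Lemma eqmodI_mul a c A A' B B' : eqmodI a c A A' -> eqmodI a c B B' -> eqmodI a c (A * B) (A' * B').
Proof.
move=> [E [F AE]] [E' [F' BE]]; exists (E * B + A' * E'), (F * B + A' * F').
have -> : A * B - A' * B' = (A - A') * B + A' * (B - B') by ring.
by rewrite AE BE; ring.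
Qed.

Lemma eqmodI_exp a c A B n : eqmodI a c A B -> eqmodI a c (A ^+ n) (B ^+ n).
Proof.
by move=> AB; elim: n => [|n IH]; rewrite ?expr0 ?exprS; [exact: eqmodI_refl | exact: eqmodI_mul].
Qed.

Lemma eqmodI_trans a c B A C : eqmodI a c A B -> eqmodI a c B C -> eqmodI a c A C.
Proof.
move=> [E [F AE]] [E' [F' BE]]; exists (E + E'), (F + F').
by rewrite -(subrKA B) AE BE; ring.
Qed.

(** In A^2 - B^2 = (A - B) (2 B + (A - B)) the second factor is even modulo c, so each squaring
    gains a factor 2 in the modulus. *)
Lemma eqmodI_sqr (j : nat) c A B : eqmodI (2 ^+ j.+1) c A B -> eqmodI (2 ^+ j.+2) c (A ^+ 2) (B ^+ 2).
Proof.
move=> [E [F AE]]; exists (B * E + 2 ^+ j * E ^+ 2), (2 * B * F + 2 * 2 ^+ j.+1 * E * F + c * F ^+ 2).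
have -> : A ^+ 2 - B ^+ 2 = (A - B) * (2 * B + (A - B)) by ring.
by rewrite AE !exprS; ring.
Qed.

Lemma eqmodI_sqrn (j i : nat) c A B : eqmodI (2 ^+ j.+1) c A B -> eqmodI (2 ^+ (j + i).+1) c (A ^+ (2 ^ i)) (B ^+ (2 ^ i)).
Proof.
move=> AB; elim: i => [|i IH]; first by rewrite addn0 expn0 !expr1.
by rewrite addnS expnSr !exprM; apply: eqmodI_sqr.
Qed.

Lemma eqmodI_coef (a : int) (N n : nat) A B : eqmodI a%:P 'X^N A B -> (n < N)%N -> (a %| A`_n - B`_n)%Z.
Proof.
by move=> [E [F AE]] nN; rewrite -coefB AE coefD coefXnM nN addr0 coefCM dvdz_mulr.
Qed.

Lemma GQ1 n a : eqmodI a 'X^(n.+1) (Gpoly n * Qpoly n) 1.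
Proof.
rewrite /Gpoly /Qpoly -big_split /=.
apply: (big_ind (fun A => eqmodI a 'X^(n.+1) A 1)); first exact: eqmodI_refl.
  by move=> A B ? ?; rewrite -[1]mulr1; apply: eqmodI_mul.
move=> j _; exists 0, (- 'X^((2 ^ j - 1) * n.+1)).
have -> : \sum_(i < n.+1) 'X^(i * 2 ^ j) = \sum_(i < n.+1) ('X^(2 ^ j)) ^+ i :> {poly int}.
  by apply: eq_bigr => i _; rewrite -exprM mulnC.
have -> : (\sum_(i < n.+1) ('X^(2 ^ j)) ^+ i) * (1 - 'X^(2 ^ j)) = 1 - ('X^(2 ^ j)) ^+ n.+1 :> {poly int}.
  by apply: oppr_inj; rewrite opprB subrX1; ring.
rewrite mulr0 add0r mulrN -exprD -exprM.
have -> : (n.+1 + (2 ^ j - 1) * n.+1 = 2 ^ j * n.+1)%N by rewrite -mulSn subn1 prednK ?expn_gt0.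
by rewrite addrAC subrr add0r.
Qed.

Lemma PpolyE q : Ppoly \Po q = (1 + q) ^+ 2 + 4 * q ^+ 2.
Proof.
rewrite /Ppoly -[1]polyC1 -[4](rmorph_nat polyC) !expr2.
by rewrite !(comp_polyD, comp_polyM, comp_polyX, comp_polyC).
Qed.

(** This is (1 - q)^2 P(q) = P(q^2) - 8 q^3. Since Q(X) = (1 - X) Q(X^2), the series 1 / Q^2
    satisfies the same equation without the last term, and P approximates it modulo 8. *)
Lemma P_comp (j : nat) : (1 - 'X^(2 ^ j)) ^+ 2 * (Ppoly \Po 'X^(2 ^ j)) =
  Ppoly \Po 'X^(2 ^ j.+1) - 8 * 'X^(3 * 2 ^ j).
Proof.
rewrite !PpolyE.
rewrite [(2 ^ j.+1)%N]expnSr [(3 * _)%N]mulnC !exprM; ring.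
Qed.

Lemma Q2P n : exists E, Qpoly n ^+ 2 * Ppoly = Ppoly \Po 'X^(2 ^ n) + 8 * E.
Proof.
elim: n => [|n [E IH]].
  by exists 0; rewrite /Qpoly big_ord0 expr1n mul1r mulr0 addr0 expn0 comp_polyXr.
exists ((1 - 'X^(2 ^ n)) ^+ 2 * E - 'X^(3 * 2 ^ n)).
rewrite /Qpoly big_ord_recr /= -/(Qpoly n) exprMn mulrAC IH mulrC mulrDr P_comp; ring.
Qed.

Lemma QP1 n : eqmodI (2 ^+ 3) 'X^(n.+1) (Qpoly n ^+ 2 * Ppoly) 1.
Proof.
have [E ->] := Q2P n; exists E, ('X^(2 ^ n - n.+1) * (2 + 5 * 'X^(2 ^ n))).
have n2 : (n < 2 ^ n)%N by exact: ltn_expl.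
rewrite mulrA -exprD subnKC // PpolyE; ring.
Qed.

(** Two squarings lift Q^2 P = 1 from modulus 8 to 32, and k - 1 >= 2 provides them. Multiplying
    (Q^2 P)^(2^(k-1)) = 1 by G^(2^k - 1) and using G Q = 1 gives the claim. *)
Lemma binpart_QP (k n : nat) : (2 < k)%N ->
  (32 %| (binpart (2 ^ k - 1) n)%:Z - (Qpoly n * Ppoly ^+ (2 ^ (k - 1)))`_n)%Z.
Proof.
move=> k3; rewrite binpart_coef; apply: (@eqmodI_coef _ n.+1) => //.
have -> : 32%:P = 2 ^+ 5 :> {poly int} by rewrite -[2](rmorph_nat (@polyC int)) -rmorphXn.
set G := Gpoly n; set Q := Qpoly n.
have H1 : eqmodI (2 ^+ 5) 'X^(n.+1) ((Q ^+ 2 * Ppoly) ^+ (2 ^ (k - 1))) 1.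
  have -> : (2 ^ (k - 1) = 2 ^ 2 * 2 ^ (k - 3))%N by rewrite -expnD; congr (2 ^ _)%N; lia.
  by have := eqmodI_exp (2 ^ (k - 3)) (@eqmodI_sqrn 2 2 _ _ _ (QP1 n)); rewrite !expr1n -exprM.
have H2 : eqmodI (2 ^+ 5) 'X^(n.+1) ((G * Q) ^+ (2 ^ k - 1)) 1.
  by rewrite -(expr1n _ (2 ^ k - 1)); apply/eqmodI_exp/GQ1.
have := eqmodI_mul H2 (eqmodI_refl (2 ^+ 5) 'X^(n.+1) (Q * Ppoly ^+ (2 ^ (k - 1)))); rewrite mul1r; apply: eqmodI_trans.
have := eqmodI_mul (eqmodI_refl (2 ^+ 5) 'X^(n.+1) (G ^+ (2 ^ k - 1))) H1; rewrite mulr1.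
have -> : (G * Q) ^+ (2 ^ k - 1) * (Q * Ppoly ^+ (2 ^ (k - 1))) =
   G ^+ (2 ^ k - 1) * (Q ^+ 2 * Ppoly) ^+ (2 ^ (k - 1)).
  have e : ((2 ^ k - 1).+1 = 2 * 2 ^ (k - 1))%N by rewrite subn1 prednK ?expn_gt0 // -expnS; congr (2 ^ _)%N; lia.
  rewrite [in LHS]exprMn [in RHS]exprMn -[LHS]mulrA; congr (_ * _); rewrite mulrA -exprSr e exprM; ring.
move=> [E [F H]]; exists (- E), (- F); rewrite -opprB H; ring.
Qed.

(** * Thue-Morse signs and reduction to nine of them *)

Fixpoint tm_rec (fuel n : nat) : int :=
  if fuel is f.+1 then (-1) ^+ odd n * tm_rec f n./2 else 1.
Definition tm (n : nat) : int := tm_rec n n.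

Lemma tm_recE f n : (n <= f)%N -> tm_rec f n = tm n.
Proof.
rewrite /tm; elim/ltn_ind: n f => n IH [|f] nf; first by case: n nf {IH}.
case: n nf IH => [|n] nf IH /=.
  by clear; rewrite mul1r; elim: f => //= f ->; rewrite mul1r.
by congr (_ * _); rewrite !IH; lia.
Qed.

Lemma tmE n : tm n = (-1) ^+ odd n * tm n./2.
Proof. by case: n => [|n] //; rewrite {1}/tm /= tm_recE //; lia. Qed.

Lemma tm_add a b j : (b < 2 ^ j)%N -> tm (2 ^ j * a + b) = tm a * tm b.
Proof.
elim: j a b => [|j IH] a b bj.
  by have -> : b = 0%N by [lia]; rewrite mul1n addn0 mulr1.
rewrite tmE [tm b]tmE expnS -mulnA oddD oddM /= halfD oddM /= mul2n doubleK add0n.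
by rewrite IH; [rewrite mulrCA | rewrite expnS in bj; lia].
Qed.

Lemma tm_sign n : tm n = 1 \/ tm n = -1.
Proof.
elim/ltn_ind: n => -[|n] IH; first by left.
by rewrite tmE; have [->|->] := IH n.+1./2 ltac:(lia); case: odd; [right|left|left|right].
Qed.

Lemma Qpoly_coef n i : (Qpoly n)`_i = if (i < 2 ^ n)%N then tm i else 0.
Proof.
elim: n i => [|n IH] i.
  by rewrite /Qpoly big_ord0 coef1; case: i => [|i].
rewrite /Qpoly big_ord_recr /= -/(Qpoly n) mulrBr mulr1 coefB coefMXn !IH expnS mul2n -addnn.
have [iN|iN] := ltnP i (2 ^ n); first by rewrite subr0 ltn_addl.
rewrite ltn_subLR // sub0r; case: ifP => h; last by rewrite oppr0.
have := @tm_add 1 (i - 2 ^ n) n; rewrite muln1 subnKC // => ->; first by rewrite mulN1r.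
by rewrite ltn_subLR.
Qed.

(** The coefficients of Q up to degree n are signs, hence odd, so the coefficient in question is
    congruent to R(1) modulo 2. This upgrades an error term 16 R to 0 modulo 32. *)
Lemma coef_shift16 n (R : {poly int}) (c : nat) : (size R <= c.+1)%N -> (c <= n)%N -> (2 %| R.[1])%Z ->
  (2 %| (Qpoly n * R)`_n)%Z.
Proof.
move=> sR cn R1; rewrite mulrC coefM.
have -> : \sum_(j < n.+1) R`_j * (Qpoly n)`_(n - j) = R.[1] - \sum_(j < n.+1) R`_j * (1 - tm (n - j)).
  rewrite (horner_coef_wide _ (leq_trans sR (_ : c.+1 <= n.+1)%N)) // -sumrB; apply: eq_bigr => j _.
  rewrite expr1n Qpoly_coef ifT; first by ring.
  by apply: leq_ltn_trans (ltn_expl n _); rewrite ?leq_subr.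
apply: rpredB => //; apply: rpred_sum => j _; apply: dvdz_mull.
by have [->|->] := tm_sign (n - j).
Qed.

Lemma PX2 j : eqmodI (2 ^+ 1) 0 (Ppoly ^+ (2 ^ j)) (1 + 'X^(2 ^ j.+1)).
Proof.
elim: j => [|j IH].
  by exists ('X + 2 * 'X^2), 0; rewrite /Ppoly expn0 !expr1; ring.
rewrite [(2 ^ j.+1)%N in X in eqmodI _ _ X _]expnSr exprM; apply: eqmodI_trans (eqmodI_exp 2 IH) _.
exists 'X^(2 ^ j.+1), 0; rewrite [(2 ^ j.+2)%N]expnSr exprM; ring.
Qed.

(** For k >= 4, P^(2^(k-4)) = 1 + X^(2^(k-3)) modulo 2, and three squarings reach modulus 16. For k
    = 3 one starts instead from P = (1 + X)^2 modulo 4 and squares twice. *)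
Lemma P16 k : (2 < k)%N -> eqmodI (2 ^+ 4) 0 (Ppoly ^+ (2 ^ (k - 1))) ((1 + 'X^(2 ^ (k - 3))) ^+ 8).
Proof.
move=> k3; have [k4|k4] := leqP k 3.
  have -> : k = 3%N by lia.
  have -> : (1 + 'X^(2 ^ (3 - 3))) ^+ 8 = ((1 + 'X) ^+ 2) ^+ (2 ^ 2) :> {poly int} by rewrite -exprM expr1.
  by apply: (@eqmodI_sqrn 1 2); exists 'X^2, 0; rewrite /Ppoly; ring.
have -> : Ppoly ^+ (2 ^ (k - 1)) = (Ppoly ^+ (2 ^ (k - 4))) ^+ (2 ^ 3).
  by rewrite -exprM -expnD; congr (_ ^+ (2 ^ _)); lia.
have -> : (k - 3 = (k - 4).+1)%N by lia.
exact: (@eqmodI_sqrn 0 3 _ _ _ (PX2 (k - 4))).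
Qed.

(** Write P^(2^(k-1)) = (1 + X^d)^8 + 16 E with d = 2^(k-3). The degree of E is at most 2^k <= n,
    and E(1) is even, so [coef_shift16] removes 16 E modulo 32; the binomial expansion gives the
    sum. *)
Lemma binpart_tm (k n : nat) : (2 < k)%N -> (2 ^ k <= n)%N ->
  (32 %| (binpart (2 ^ k - 1) n)%:Z - \sum_(i < 9) 'C(8, i)%:Z * tm (n - 2 ^ (k - 3) * i))%Z.
Proof.
move=> k3 kn; rewrite -[_ - _](subrKA (Qpoly n * Ppoly ^+ (2 ^ (k - 1)))`_n).
apply: rpredD; first exact: binpart_QP.
have [E [F PE]] := P16 k3; rewrite mul0r addr0 in PE.
have kk : (2 ^ (k - 1) * 2 = 2 ^ k)%N by rewrite -expnSr; congr (2 ^ _)%N; lia.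
have dk : (2 ^ (k - 3) * 8 = 2 ^ k)%N by rewrite -(expnD 2 _ 3); congr (2 ^ _)%N; lia.
(* Since P(1) = 8, 16 E(1) = 8^(2^(k-1)) - 2^8, a multiple of 32. *)
have E1 : (2 %| E.[1])%Z.
  have : (Ppoly ^+ (2 ^ (k - 1)) - (1 + 'X^(2 ^ (k - 3))) ^+ 8).[1] = 16 * E.[1].
    by rewrite PE hornerM -[2](rmorph_nat (@polyC int)) -rmorphXn hornerC.
  have -> : (Ppoly ^+ (2 ^ (k - 1)) - (1 + 'X^(2 ^ (k - 3))) ^+ 8).[1] = 8 ^+ (2 ^ (k - 1)) - 2 ^+ 8.
    by rewrite /Ppoly !(hornerE, horner_exp) !expr1n.
  have -> : (2 ^ (k - 1) = (2 ^ (k - 1) - 2).+2)%N.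
    have : (2 ^ 2 <= 2 ^ (k - 1))%N by rewrite leq_exp2l //; lia.
    by lia.
  by rewrite 2!exprS; move: (8 ^+ _) => z; lia.
have sE : (size E <= (2 ^ k).+1)%N.
  have -> : size E = size (2 ^+ 4 * E).
    by rewrite -[2](rmorph_nat (@polyC int)) -rmorphXn size_Cmul.
  rewrite -PE; apply: leq_trans (size_polyD _ _) _; rewrite size_polyN geq_max; apply/andP; split.
    apply: leq_trans (size_poly_exp_leq _ _) _; rewrite -kk mulnC ltnS leq_mul2l.
    apply/orP; right.
    suff : (size Ppoly <= 3)%N by lia.
    apply: leq_trans (size_polyD _ _) _; rewrite -[4](rmorph_nat (@polyC int)) geq_max; apply/andP; split.
      apply: leq_trans (size_poly_exp_leq _ _) _; rewrite addrC -[1]polyC1 size_XaddC //.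
    by rewrite mul_polyC (leq_trans (size_scale_leq _ _)) ?size_polyXn.
  apply: leq_trans (size_poly_exp_leq _ _) _; rewrite -dk ltnS leq_mul2r; apply/orP; right.
  by rewrite addrC -[1]polyC1 size_XnaddC ?expn_gt0.
have -> : Qpoly n * Ppoly ^+ (2 ^ (k - 1)) = Qpoly n * (1 + 'X^(2 ^ (k - 3))) ^+ 8 + 16%:P * (Qpoly n * E).
  have -> : 16%:P = 2 ^+ 4 :> {poly int} by rewrite -[2](rmorph_nat (@polyC int)) -rmorphXn.
  by move/eqP: PE; rewrite subr_eq => /eqP ->; ring.
have -> : \sum_(i < 9) 'C(8, i)%:Z * tm (n - 2 ^ (k - 3) * i) = (Qpoly n * (1 + 'X^(2 ^ (k - 3))) ^+ 8)`_n.
  rewrite exprDn mulr_sumr coef_sum; apply: eq_bigr => i _.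
  rewrite expr1n mul1r -exprM mulrnAr coefMn coefMXn ltnNge.
  have i9 : (2 ^ (k - 3) * i <= n)%N by apply: leq_trans kn; rewrite -dk leq_mul2l orbC -ltnS ltn_ord.
  rewrite i9 [negb _]/= Qpoly_coef ifT; first by rewrite -mulr_natl; congr (_ * _); exact/esym/natz.
  by apply: leq_ltn_trans (ltn_expl n _); rewrite ?leq_subr.
rewrite coefD addrAC subrr add0r coefCM.
by have /dvdzP[q ->] := coef_shift16 sE kn E1; apply/dvdzP; exists q; ring.
Qed.

(** Write n = d (8 h + c) + r with c < 8 and r < d. Then t at n - d i is t_r t_h t_(c-i) for i <= c
    and t_r t_(h-1) t_(8+c-i) otherwise, so the nine terms combine to t_r (al t_h + ga t_(h-1)) with
    al, ga depending on c alone. *)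
Lemma binpart_mod32 (k n : nat) : (2 < k)%N -> (2 ^ k <= n)%N ->
  let h := (n %/ 2 ^ k)%N in let b := binpart (2 ^ k - 1) n in
  if tm h == tm h.-1 then (32 %| b%:Z + 4 * tm n)%Z else (b %% 4 == 2)%N.
Proof.
move=> k3 kn; pose h := (n %/ 2 ^ k)%N; pose b := binpart (2 ^ k - 1) n.
rewrite -/h -/b.
have dk : (2 ^ k = 2 ^ (k - 3) * 8)%N by rewrite -(expnD 2 _ 3); congr (2 ^ _)%N; lia.
have := binpart_tm k3 kn; rewrite -/b.
pose d := (2 ^ (k - 3))%N; have d0 : (0 < d)%N by rewrite expn_gt0.
pose r := (n %% d)%N; pose c := ((n %/ d) %% 8)%N.
have rd : (r < d)%N by rewrite ltn_mod.
have nE : n = (d * (8 * h + c) + r)%N.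
  have h8 : h = ((n %/ d) %/ 8)%N by rewrite -divnMA /h dk.
  by rewrite {1}(divn_eq n d) {1}(divn_eq (n %/ d) 8) -h8 -/c -/r; ring.
have c8 : (c < 8)%N by rewrite ltn_mod.
have h0 : (0 < h)%N by rewrite divn_gt0 ?expn_gt0.
have tmn i : (i < 9)%N -> tm (n - d * i) =
    tm r * (if (i <= c)%N then tm h * tm (c - i) else tm h.-1 * tm (8 + c - i)).
  move=> i9; rewrite nE -/d.
  have -> : (d * (8 * h + c) + r - d * i = d * (8 * h + c - i) + r)%N.
    by rewrite mulnBr addnBAC // leq_mul2l; apply/orP; right; lia.
  rewrite tm_add // mulrC; congr (_ * _); case: ifP => ic.
    by rewrite -addnBA // (@tm_add h (c - i) 3) //; lia.
  have -> : (8 * h + c - i = 2 ^ 3 * h.-1 + (8 + c - i))%N by lia.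
  by rewrite tm_add //; lia.
rewrite (eq_bigr (fun i : 'I_9 => tm r * (tm h * (if (i <= c)%N then 'C(8, i)%:Z * tm (c - i) else 0) +
     tm h.-1 * (if (i <= c)%N then 0 else 'C(8, i)%:Z * tm (8 + c - i))))); last first.
  by move=> i _; rewrite tmn //; case: ifP => _; ring.
rewrite -mulr_sumr big_split /= -!mulr_sumr.
have -> : tm n = tm r * (tm h * tm c) by rewrite -(subn0 n) -(muln0 d) tmn // leq0n subn0.
(* For each of the eight values of c: al + ga = -4 t_c modulo 32 and al - ga = 2 modulo 4, by
   computation. *)
have [] : (32 %| \sum_(i < 9) (if (i <= c)%N then 'C(8, i)%:Z * tm (c - i) else 0) +
      \sum_(i < 9) (if (i <= c)%N then 0 else 'C(8, i)%:Z * tm (8 + c - i)) + 4 * tm c)%Z /\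
    (((\sum_(i < 9) (if (i <= c)%N then 'C(8, i)%:Z * tm (c - i) else 0) -
      \sum_(i < 9) (if (i <= c)%N then 0 else 'C(8, i)%:Z * tm (8 + c - i))) %% 4)%Z = 2).
  rewrite !big_ord_recl !big_ord0; clear -c8; move: c c8 => c.
  by do 8 (case: c => [_|c]; first by split; vm_compute).
move: b => b; have := tm_sign r; have := tm_sign h; have := tm_sign h.-1; move: (tm r) (tm h) (tm h.-1) (tm c).
move: (\sum_(_ < _) _) (\sum_(_ < _) _) => al ga; clear.
by move=> x y z t [->|->] [->|->] [->|->] /=; lia.
Qed.

(** * Counting *)

Definition tmrep (h : nat) : bool := tm h == tm h.-1.

Lemma tmrep_double h : (0 < h)%N -> tmrep (2 * h) = ~~ tmrep h.
Proof.
case: h => // h _; rewrite /tmrep.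
have E1 : tm (2 * h.+1) = tm h.+1 by rewrite tmE mul2n odd_double doubleK mul1r.
have E2 : tm (2 * h.+1).-1 = - tm h.
  have -> : (2 * h.+1).-1 = (2 * h + 1)%N by lia.
  by rewrite tmE mul2n addn1 /= odd_double uphalf_double mulN1r.
by rewrite E1 E2; have [->|->] := tm_sign h; have [->|->] := tm_sign h.+1.
Qed.

Lemma tmrep_odd h : tmrep (2 * h + 1) = false.
Proof.
rewrite /tmrep addn1 /= tmE /= mul2n odd_double /= uphalf_double mulN1r.
have -> : tm h.*2 = tm h by rewrite tmE odd_double doubleK mul1r.
by have [->|->] := tm_sign h.
Qed.

Definition repcnt (H : nat) : nat := count tmrep (iota 1 H).

Lemma repcntS H : repcnt H.+1 = (repcnt H + tmrep H.+1)%N.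
Proof. by rewrite /repcnt -(addn1 H) iotaD count_cat /= addn0 add1n addn1. Qed.

Definition rdev (H : nat) : int := 3 * (repcnt H)%:Z - H%:Z.

(** Odd indices never count, and 2 h counts exactly when h does not, so f(2 h) = f(2 h + 1) = h -
    f(h). *)
Lemma rdev_rec h : rdev (2 * h) = - rdev h /\ rdev (2 * h + 1) = - rdev h - 1.
Proof.
have r1 m : repcnt (2 * m + 1) = repcnt (2 * m).
  by rewrite addn1 repcntS -(addn1 (2 * m)) tmrep_odd addn0.
have r2 m : repcnt (2 * m.+1) = (repcnt (2 * m) + ~~ tmrep m.+1)%N.
  rewrite -tmrep_double //; have -> : (2 * m.+1 = (2 * m + 1).+1)%N by lia.
  by rewrite repcntS r1.
have E : (repcnt (2 * h) + repcnt h = h)%N.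
  by elim: h => // h IH; rewrite r2 repcntS; case: tmrep; lia.
by rewrite /rdev r1; split; lia.
Qed.

Lemma rdev_rec4 h : [/\ rdev (4 * h) = rdev h, rdev (4 * h + 1) = rdev h - 1,
   rdev (4 * h + 2) = rdev h + 1 & rdev (4 * h + 3) = rdev h].
Proof.
have [a b] := rdev_rec h; have [c d] := rdev_rec (2 * h); have [e f] := rdev_rec (2 * h + 1).
have -> : (4 * h = 2 * (2 * h))%N by lia.
have -> : (2 * (2 * h) + 2 = 2 * (2 * h + 1))%N by lia.
have -> : (2 * (2 * h) + 3 = 2 * (2 * h + 1) + 1)%N by lia.
by rewrite c d e f a b; split; lia.
Qed.

Lemma rdev_bound l H : (H < 4 ^ l)%N -> `|rdev H| <= l%:Z.
Proof.
elim: l H => [|l IH] H; first by case: H.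
rewrite expnS => Hl; have [a b c d] := rdev_rec4 (H %/ 4).
have /IH {}IH : (H %/ 4 < 4 ^ l)%N by rewrite ltn_divLR // mulnC.
have := divn_eq H 4; have : (H %% 4 < 4)%N by rewrite ltn_mod.
rewrite [(_ * 4)%N]mulnC; case: (H %% 4)%N => [|[|[|[|//]]]] _ HE.
- by rewrite HE addn0 a; lia.
- by rewrite HE b; lia.
- by rewrite HE c; lia.
- by rewrite HE d; lia.
Qed.

Lemma rdev_step H : `|rdev H.+1 - rdev H| <= 2.
Proof. by rewrite /rdev repcntS; case: tmrep; lia. Qed.

Lemma iota_shift m n : iota m n = [seq (m + r)%N | r <- iota 0 n].
Proof. by rewrite -iotaDl addn0. Qed.

(** Since t_(2^j + r) = - t_r for r < 2^j, the upper half contributes what the lower half omits. *)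
Lemma count_tm (s : int) j : s = 1 \/ s = -1 -> count (fun r => tm r == s) (iota 0 (2 ^ j.+1)) = (2 ^ j)%N.
Proof.
move=> hs; rewrite expnS mul2n -addnn iotaD count_cat add0n (iota_shift (2 ^ j)) count_map.
rewrite -[RHS](size_iota 0) -[in RHS](count_predC (fun r => tm r == s)); congr (_ + _)%N.
apply: eq_in_count => r; rewrite mem_iota /= => rj.
rewrite -{1}[(2 ^ j)%N]muln1 tm_add //.
by have [->|->] := tm_sign r; case: hs => ->.
Qed.

(** In the block of quotient h one has t_n = t_h t_r, and half of the remainders r satisfy t_r =
    t_h. So the block contributes 2^k if [tmrep] h and nothing otherwise. Block 0, where a is
    unknown, is kept as it is. *)
Lemma count_blocks (a : pred nat) k H :
  (forall n, (2 ^ k.+1 <= n)%N -> a n = tmrep (n %/ 2 ^ k.+1) && (tm n == 1)) ->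
  count a (iota 0 (2 ^ k.+1 * H.+1)) = (count a (iota 0 (2 ^ k.+1)) + 2 ^ k * repcnt H)%N.
Proof.
move=> aE; elim: H => [|H IH]; first by rewrite muln1 /repcnt /= muln0 addn0.
rewrite mulnS addnC iotaD count_cat IH repcntS mulnDr addnA; congr (_ + _)%N.
rewrite add0n iota_shift count_map.
have tmH r : (r < 2 ^ k.+1)%N -> tm (2 ^ k.+1 * H.+1 + r) = tm H.+1 * tm r by exact: tm_add.
rewrite (eq_in_count (a2 := fun r => tmrep H.+1 && (tm r == tm H.+1))); last first.
  move=> r; rewrite mem_iota /= => rk; rewrite aE; last by rewrite mulnS -addnA leq_addr.
  rewrite tmH // [(_ * H.+1)%N]mulnC divnMDl ?expn_gt0 // divn_small // addn0; congr (_ && _).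
  by have [->|->] := tm_sign r; have [->|->] := tm_sign H.+1.
case: tmrep; last by rewrite muln0 (eq_count (a2 := pred0)) ?count_pred0.
by rewrite muln1 count_tm //; exact: tm_sign.
Qed.

(** * Residues modulo 32 and sums of three squares *)

Definition three_sq (n : nat) : Prop := exists x y z : int, n%:Z = x ^+ 2 + y ^+ 2 + z ^+ 2.

Lemma sqr_mod8 (x : int) : ((x ^+ 2) %% 8)%Z \in [:: 0; 1; 4].
Proof.
have [q [r [-> r8]]] : exists q r : int, x = 4 * q + r /\ r \in [:: 0; 1; 2; 3].
  by exists (x %/ 4)%Z, (x %% 4)%Z; rewrite !inE; lia.
have -> : ((4 * q + r) ^+ 2 %% 8)%Z = (r ^+ 2 %% 8)%Z.
  have -> : (4 * q + r) ^+ 2 = 8 * (2 * q ^+ 2 + q * r) + r ^+ 2 by ring.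
  by move: (2 * q ^+ 2 + q * r) (r ^+ 2) => u v; lia.
by move: r8; rewrite !inE => /or4P[] /eqP ->.
Qed.

(** A sum of three squares divisible by 4 has all terms even; dividing by 4 leaves a number that is
    7 modulo 8. *)
Lemma not_three_sq28 n : (n %% 32 = 28)%N -> ~ three_sq n.
Proof.
move=> n28 [x [y [z E]]].
have ev (u : int) : ((u ^+ 2) %% 8)%Z != 1 -> (2 %| u)%Z.
  move=> u1; have [//|[q uE]] : (2 %| u)%Z \/ exists q, u = 2 * q + 1.
    by case: (boolP (2 %| u)%Z) => ?; [left | right; exists (u %/ 2)%Z; lia].
  case/negP: u1; have [r [rE|rE]] : exists r, q = 2 * r \/ q = 2 * r + 1 by exists (q %/ 2)%Z; lia.
    have -> : u ^+ 2 = 8 * (2 * r ^+ 2 + r) + 1 by rewrite uE rE; ring.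
    by move: (2 * _ + r) => w; lia.
  have -> : u ^+ 2 = 8 * (2 * r ^+ 2 + 3 * r + 1) + 1 by rewrite uE rE; ring.
  by move: (2 * _ + _ + 1) => w; lia.
have [/dvdzP[a xE] /dvdzP[b yE] /dvdzP[c zE]] : [/\ (2 %| x)%Z, (2 %| y)%Z & (2 %| z)%Z].
  have := sqr_mod8 x; have := sqr_mod8 y; have := sqr_mod8 z.
  move: (ev x) (ev y) (ev z) E; move: (x ^+ 2) (y ^+ 2) (z ^+ 2) => u v w ex ey ez E.
  by rewrite !inE => hw hv hu; split; [apply: ex|apply: ey|apply: ez]; lia.
have E4 : n%:Z = 4 * (a ^+ 2 + b ^+ 2 + c ^+ 2) by rewrite E xE yE zE; ring.
have := sqr_mod8 a; have := sqr_mod8 b; have := sqr_mod8 c.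
by move: E4; move: (a ^+ 2) (b ^+ 2) (c ^+ 2) => u v w; rewrite !inE; lia.
Qed.

Lemma three_sq4 n : (n %% 32 = 4)%N -> three_sq n.
Proof.
move=> n4; have [m nE] : exists m, n = (4 * m)%N by exists (n %/ 4)%N; lia.
have [|x [y [z E]]] := @three_squares m; first by left; lia.
by exists (2 * x), (2 * y), (2 * z); rewrite nE PoszM E; ring.
Qed.

(** When [tmrep] holds, the residue modulo 32 is 28 for t_n = 1 and 4 for t_n = -1. Otherwise it is
    2 modulo 4, and [three_squares] applies. *)
Lemma three_sq_binpart k n : (2 < k)%N -> (2 ^ k <= n)%N ->
  ~ three_sq (binpart (2 ^ k - 1) n) <-> tmrep (n %/ 2 ^ k) && (tm n == 1).
Proof.
move=> k3 kn; have := binpart_mod32 k3 kn; rewrite /= -/(tmrep _).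
move: (binpart _ _) => b; case: ifP => [_ b32|_ /eqP b4]; last first.
  by split=> // h; exfalso; apply: h; apply: three_squares; right.
have [tE|tE] := tm_sign n; rewrite tE in b32 *; split=> //= h; [|exfalso; apply: h].
  by apply: not_three_sq28; lia.
by apply: three_sq4; lia.
Qed.

Local Open Scope classical_set_scope.
Local Open Scope ring_scope.

(** * The counting function, its error term and the density *)

Lemma counting_funE (R : realType) (A : set nat) (x : R) : 0 <= x ->
  counting_fun A x = count (fun n => `[< A n >]) (iota 0 (Num.trunc x).+1).
Proof.
move=> x0; rewrite /counting_fun; set s := iota _ _.
have memS n : (n \in [fset n in [seq n <- s | `[< A n >]]]%fset) = `[< A n >] && (n%:R <= x).
  by rewrite !inE mem_filter mem_iota add0n ltnS truncn_ge_nat.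
have -> : A `&` [set n | n%:R <= x] = [set` [fset n in [seq n <- s | `[< A n >]]]%fset].
  apply/seteqP; split=> n; rewrite [X in X -> _]/= [X in _ -> X]/= memS.
    by move=> [An nx]; rewrite nx asboolT.
  by move=> /andP[/asboolP].
by rewrite set_fsetK card_fseq undup_id ?filter_uniq ?iota_uniq // size_filter.
Qed.

Lemma count_iota_le (a : pred nat) m n : (m <= n)%N -> (count a (iota 0 m) <= count a (iota 0 n))%N.
Proof. by move=> mn; rewrite -(subnKC mn) iotaD count_cat leq_addr. Qed.

Lemma log2_ge (R : realType) (a : nat) (x : R) : 2 ^+ a <= x -> a%:R <= log2 x.
Proof.
move=> ax; have x0 : 0 < x by apply: lt_le_trans ax; rewrite exprn_gt0.
have l2 : 0 < ln (2 : R) by rewrite ln_gt0 // ltr1n.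
by rewrite /log2 ler_pdivlMr // mulr_natl -lnXn // ler_ln ?posrE ?exprn_gt0.
Qed.

Lemma log2_le (R : realType) (a : nat) (x : R) : 0 < x -> x <= 2 ^+ a -> log2 x <= a%:R.
Proof.
move=> x0 ax; have l2 : 0 < ln (2 : R) by rewrite ln_gt0 // ltr1n.
by rewrite /log2 ler_pdivrMr // mulr_natl -lnXn // ler_ln ?posrE ?exprn_gt0.
Qed.

Lemma asymp_bounded (R : realType) (a c : nat -> R) (D B : R) : 0 < B ->
  (forall l, `|a l - c l| <= D) -> (forall l, B * l.+1%:R <= `|c l|) -> asymp_equiv a c.
Proof.
move=> B0 aD cB; apply/cvgrPdist_le => e e0; near=> l.
have c0 : 0 < `|c l| by apply: lt_le_trans (cB l); rewrite mulr_gt0.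
have cn : c l != 0 by rewrite -normr_gt0.
have -> : 1 - a l / c l = (c l - a l) / c l by field.
rewrite normrM normfV ler_pdivrMr // distrC (le_trans (aD l)) //.
apply: (@le_trans _ _ (e * (B * l.+1%:R))); last by rewrite ler_wpM2l // ltW.
rewrite mulrA -ler_pdivrMl ?mulr_gt0 // mulrC.
apply: (@le_trans _ _ l%:R); last by rewrite ler_nat.
near: l; exact: nbhs_infty_ger.
Unshelve. all: by end_near. Qed.

Lemma not_three_squaresE k n : (2 < k)%N -> (2 ^ k <= n)%N ->
  `[< not_three_squares (2 ^ k - 1) n >] = tmrep (n %/ 2 ^ k) && (tm n == 1).
Proof.
move=> k3 kn; have [H1 H2] := three_sq_binpart k3 kn.
apply/asboolP/idP => [An|/H2 h x y z E].
  by apply: H1 => -[x [y [z E]]]; apply: (An x y z).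
by apply: h; exists x, y, z.
Qed.

(** Compare [0, x] with the complete blocks up to H - 1 and up to H. Block 0 contributes between 0
    and 2^k, hence the 6; the 2 comes from x <= 2^k ((H - 1) + 2). *)
Lemma counting_bounds (R : realType) k (x : R) : (2 < k)%N -> 2 ^+ k <= x ->
  let H := (Num.trunc x %/ 2 ^ k)%N in
  let C : R := (counting_fun (not_three_squares (2 ^ k - 1)) x)%:R in
  [/\ (0 < H)%N, 2 ^+ k * H%:R <= x, 6 * C - x <= 2 ^+ k * (6 + (rdev H)%:~R) &
      2 ^+ k * ((rdev H.-1)%:~R - 2) <= 6 * C - x].
Proof.
move=> k3 kx H; have x0 : 0 <= x by apply: le_trans kx; rewrite exprn_ge0.
rewrite counting_funE //; set a := (fun n => _).
have K0 : (0 < 2 ^ k)%N by rewrite expn_gt0.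
have H0 : (0 < H)%N by rewrite divn_gt0 // truncn_ge_nat // natrX.
have [X1 X2] : (2 ^ k * H <= Num.trunc x)%N /\ ((Num.trunc x).+1 <= 2 ^ k * H.+1)%N.
  by split; [rewrite mulnC leq_divM | rewrite mulnC ltn_ceil].
have [x1 x2] : 2 ^+ k * H%:R <= x /\ x <= 2 ^+ k * H.+1%:R.
  have := truncn_itv x0; rewrite -natrX -!natrM => /andP[t1 t2]; split.
    by apply: le_trans t1; rewrite ler_nat.
  by apply/ltW/(lt_le_trans t2); rewrite ler_nat.
have kE : k = k.-1.+1 by rewrite prednK //; apply: leq_trans k3.
have blocks h : count a (iota 0 (2 ^ k * h.+1)) = (count a (iota 0 (2 ^ k)) + 2 ^ k.-1 * repcnt h)%N.
  by rewrite kE; apply: count_blocks; rewrite -kE => n; exact: not_three_squaresE.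
have repE h : 6 * (2 ^ k.-1 * repcnt h)%N%:R = 2 ^+ k * ((rdev h)%:~R + h%:R) :> R.
  have -> : (rdev h)%:~R + h%:R = 3 * (repcnt h)%:R :> R.
    by rewrite /rdev rmorphB rmorphM /= rmorph_nat -!pmulrn; ring.
  have -> : 2 ^+ k = 2 * 2 ^+ k.-1 :> R by rewrite {1}kE exprS.
  by rewrite natrM natrX; ring.
have s0 : (count a (iota 0 (2 ^ k)) <= 2 ^ k)%N by rewrite (leq_trans (count_size _ _)) ?size_iota.
split=> //.
- have : (count a (iota 0 (Num.trunc x).+1) <= 2 ^ k + 2 ^ k.-1 * repcnt H)%N.
    by rewrite (leq_trans (count_iota_le _ X2)) // blocks leq_add2r.
  rewrite -(ler_nat R) natrD natrX => h; have := repE H; move: x1 h.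
  by move: (_%:R) (_%:R) (_%:R) => *; lra.
have HE : H = H.-1.+1 by rewrite prednK.
have : (2 ^ k.-1 * repcnt H.-1 <= count a (iota 0 (Num.trunc x).+1))%N.
  by apply: leq_trans (count_iota_le _ (leqW X1)); rewrite {2}HE blocks leq_addl.
have {}x2 : x <= 2 ^+ k * (H.-1%:R + 2).
  by apply: le_trans x2 _; rewrite {1}HE -[H.-1.+2]addn2 natrD.
move: (count a _) => c; rewrite -(ler_nat R); have := repE H.-1.
by move: (_ * repcnt _)%N%:R c%:R x2; move: (_%:~R) (_%:R) (2 ^+ k) => *; lra.
Qed.

(** Let 4^l <= H < 4^(l+1). Then x >= 2^k 4^l, and [rdev] at H and H - 1 is at most l + 1 in
    absolute value, so 6 + (l + 1) = l + 7 bounds both sides. *)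
Lemma counting_bound4 (R : realType) k (x : R) : (2 < k)%N -> 2 ^+ k <= x ->
  exists2 l : nat, (k + 2 * l)%N%:R <= log2 x &
    `|6 * (counting_fun (not_three_squares (2 ^ k - 1)) x)%:R - x| <= 2 ^+ k * (l + 7)%N%:R.
Proof.
move=> k3 kx; have [H0 x1 up lo] := counting_bounds k3 kx; set H := (_ %/ _)%N in H0 x1 up lo.
have /andP[lH Hl] := trunc_log_bounds (isT : (1 < 4)%N) H0; move: (trunc_log 4 H) lH Hl => l lH Hl.
exists l.
  apply: log2_ge; apply: le_trans x1; rewrite exprD ler_wpM2l ?exprn_ge0 //.
  by rewrite -natrX ler_nat expnM.
have r1 : `|(rdev H)%:~R| <= l.+1%:R :> R.
  by rewrite -intr_norm -[_%:R]/(_%:Z%:~R) ler_int rdev_bound.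
have r2 : `|(rdev H.-1)%:~R| <= l.+1%:R :> R.
  by rewrite -intr_norm -[_%:R]/(_%:Z%:~R) ler_int rdev_bound // (leq_ltn_trans (leq_pred _)).
rewrite ler_norml; apply/andP; split.
  apply: le_trans lo; rewrite -mulrN ler_wpM2l ?exprn_ge0 //.
  by move: r2; rewrite ler_norml natrD -natr1 => /andP[]; lra.
apply: le_trans up _; rewrite ler_wpM2l ?exprn_ge0 //.
by move: r1; rewrite ler_norml natrD -natr1 => /andP[]; lra.
Qed.

Lemma counting_log2_bound (R : realType) k (x : R) : (2 < k)%N -> 2 ^+ k <= x ->
  `|(counting_fun (not_three_squares (2 ^ k - 1)) x)%:R - x / 6| <= 2 ^+ (k - 2) / 3 * (log2 x - k%:R + 26).
Proof.
move=> k3 kx; have [l lx b] := counting_bound4 k3 kx.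
set A := not_three_squares _.
have -> : 2 ^+ (k - 2) = 2 ^+ k / 4 :> R.
  have {2}-> : k = (2 + (k - 2))%N by lia.
  by rewrite exprD; field.
have -> : (counting_fun A x)%:R - x / 6 = (6 * (counting_fun A x)%:R - x) / 6 by field.
rewrite normrM normfV normr_nat ler_pdivrMr //; apply: (le_trans b).
have -> : 2 ^+ k / 4 / 3 * (log2 x - k%:R + 26) * 6 = 2 ^+ k * ((log2 x - k%:R + 26) / 2) :> R by field.
rewrite ler_wpM2l ?exprn_ge0 //.
move: lx; rewrite [in X in X -> _]natrD natrM natrD; move: (log2 x) (k%:R) (ler0n R l); move: (l%:R) => *; lra.
Qed.

Lemma counting_density (R : realType) k : (2 < k)%N ->
  (counting_fun (not_three_squares (2 ^ k - 1)) x)%:R / x @[x --> +oo] --> (6^-1 : R).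
Proof.
move=> k3; set A := not_three_squares _.
apply/cvgrPdist_le => e e0.
have l2 : 0 < ln (2 : R) by rewrite ln_gt0 // ltr1n.
pose B : R := 2 ^+ (k - 2) / 3; have B0 : 0 < B by rewrite divr_gt0 ?exprn_gt0.
(* With y = sqrt x >= 1, ln x = 2 ln y <= 2 y, so the error is at most D y, and this is at most e x
   once y >= D / e. *)
pose D : R := B * (2 / ln 2 + 26); have D0 : 0 < D by rewrite mulr_gt0 // addr_gt0 // divr_gt0.
near=> x.
have kx : 2 ^+ k <= x by near: x; apply: nbhs_pinfty_ge; rewrite num_real.
have x1 : 1 <= x by apply: le_trans kx; rewrite exprn_ege1 // ler1n.
have x0 : 0 < x by apply: lt_le_trans x1.
pose y := Num.sqrt x; have xy : x = y ^+ 2 by rewrite sqr_sqrtr // ltW.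
have y1 : 1 <= y by rewrite -sqrtr1 ler_sqrt.
have y0 : 0 < y by apply: lt_le_trans y1.
have De : D / e <= y.
  have xD : (D / e) ^+ 2 <= x by near: x; apply: nbhs_pinfty_ge; rewrite num_real.
  by rewrite -(ger0_norm (divr_ge0 (ltW D0) (ltW e0))) -sqrtr_sqr ler_sqrt // ltW.
have -> : 6^-1 - (counting_fun A x)%:R / x = (x / 6 - (counting_fun A x)%:R) / x.
  by field; rewrite gt_eqF.
rewrite normrM normfV (gtr0_norm x0) ler_pdivrMr // distrC.
apply: (le_trans (counting_log2_bound k3 kx)); rewrite -/B.
have lx : log2 x <= 2 / ln 2 * y.
  rewrite /log2 xy lnXn // -[ln y *+ 2]mulr_natl ler_pdivrMr // mulrAC divfK ?gt_eqF //.
  by rewrite ler_pM2l // ltW // ln_sublinear.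
apply: (@le_trans _ _ (D * y)).
  rewrite /D -mulrA ler_pM2l // mulrDl.
  have k0 : 0 <= k%:R :> R by [].
  have : 26 <= 26 * y by rewrite ler_peMr.
  by move: lx; move: (log2 x) (_ * y) (26 * y) (k%:R) k0 => *; lra.
rewrite xy expr2 mulrA ler_pM2r //.
by move: De; rewrite ler_pdivrMr // mulrC.
Unshelve. all: by end_near. Qed.

(** * Sequences along which the error is extremal *)

Fixpoint extremal (c l : nat) : nat := if l is l'.+1 then 4 * extremal c l' + c else c.

Lemma extremal_bounds c l : (0 < c <= 2)%N -> (4 ^ l <= extremal c l < 4 ^ l.+1)%N.
Proof.
by move=> c2; elim: l => [|l] /=; rewrite !expnS ?expn0; lia.
Qed.

Lemma rdev_extremal l : rdev (extremal 2 l) = l.+1%:Z /\ rdev (extremal 1 l) = - l.+1%:Z.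
Proof.
elim: l => [|l [IH2 IH1]] //=.
have [_ _ -> _] := rdev_rec4 (extremal 2 l); have [_ -> _ _] := rdev_rec4 (extremal 1 l).
by rewrite IH1 IH2; split; lia.
Qed.

Lemma increasing_extremal k c : (0 < c)%N -> increasing_seq (fun l => (2 ^ k * extremal c l)%N).
Proof.
move=> c0; apply/increasing_seqP => l; rewrite ltEnat /= ltn_pmul2l ?expn_gt0 //; lia.
Qed.

(** At x = 2^k u_l the block index H is u_l. [counting_bounds], with [rdev_step] to pass from H - 1
    to H, gives 6 C - x = 2^k s (l + 1) up to a bounded error, and log2 x is 2 l up to a bounded
    error. *)
Lemma asymp_extremal (R : realType) k (u : nat -> nat) (s : int) : (2 < k)%N -> `|s| = 1 ->
  (forall l, rdev (u l) = s * l.+1%:Z) -> (forall l, 4 ^ l <= u l < 4 ^ l.+1)%N ->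
  let m l : R := (2 ^ k * u l)%N%:R in
  asymp_equiv (fun l => (counting_fun (not_three_squares (2 ^ k - 1)) (m l))%:R - m l / 6)
    (fun l => s%:~R * (2 ^+ (k - 2) / 3 * log2 (m l))).
Proof.
move=> k3 s1 ru bu m; set A := not_three_squares _.
have K0 : 0 < 2 ^+ k :> R by rewrite exprn_gt0.
have -> : 2 ^+ (k - 2) = 2 ^+ k / 4 :> R.
  have {2}-> : k = (2 + (k - 2))%N by lia.
  by rewrite exprD; field.
have log l : (k + 2 * l)%N%:R <= log2 (m l) <= (k + 2 * l.+1)%N%:R.
  have /andP[b1 b2] := bu l; rewrite log2_ge ?log2_le //.
  - by rewrite /m ltr0n muln_gt0 expn_gt0 (leq_trans _ b1) ?expn_gt0.
  - by rewrite /m -natrX ler_nat expnD leq_mul2l expnM ltnW ?orbT.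
  - by rewrite /m -natrX ler_nat expnD leq_mul2l expnM b1 orbT.
(* In the first constant, 6 comes from [counting_bounds] and k + 2 from replacing l + 1 by half of
   log2. The second reflects log2 >= k + 2 l >= l + 1. *)
apply: (@asymp_bounded _ _ _ (2 ^+ k * (k + 8)%N%:R) (2 ^+ k / 12)) => [|l|l]; first by rewrite divr_gt0.
  have /andP[b1 b2] := bu l; have /andP[l1 l2] := log l.
  have u0 : (0 < u l)%N by rewrite (leq_trans _ b1) ?expn_gt0.
  have km : 2 ^+ k <= m l by rewrite /m -natrX ler_nat leq_pmulr.
  have [_ _] := counting_bounds k3 km; rewrite {1 3}/m natrK mulKn ?expn_gt0 // -/A.
  have st := rdev_step (u l).-1; rewrite prednK // in st.
  have {st} : (rdev (u l))%:~R - 2 <= (rdev (u l).-1)%:~R :> R.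
    by rewrite -[2]/(2%:~R) -rmorphB ler_int; lia.
  rewrite ru rmorphM /= -[l.+1%:Z%:~R]/(l.+1%:R).
  move: (m l) (log2 (m l)) (counting_fun A (m l))%:R (rdev (u l).-1)%:~R l1 l2 => x L C r l1 l2 r1 up lo.
  have -> : C - x / 6 - s%:~R * (2 ^+ k / 4 / 3 * L) =
     ((6 * C - x - 2 ^+ k * (s%:~R * l.+1%:R)) + 2 ^+ k * (s%:~R * (l.+1%:R - L / 2))) / 6 by field.
  rewrite normrM normfV normr_nat ler_pdivrMr // (le_trans (ler_normD _ _)) //.
  have b3 : `|6 * C - x - 2 ^+ k * (s%:~R * l.+1%:R)| <= 2 ^+ k * 6.
    rewrite ler_norml; apply/andP; split; last by move: up; rewrite mulrDr; lra.
    apply: (@le_trans _ _ (2 ^+ k * (r - 2) - 2 ^+ k * (s%:~R * l.+1%:R))); last by rewrite lerD2r.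
    rewrite -subr_ge0 (_ : _ - _ = 2 ^+ k * (r - 2 - s%:~R * l.+1%:R + 6)); last by ring.
    by rewrite mulr_ge0 ?(ltW K0) //; lra.
  have b4 : `|2 ^+ k * (s%:~R * (l.+1%:R - L / 2))| <= 2 ^+ k * (k%:R + 2).
    rewrite normrM gtr0_norm // ler_pM2l // normrM -intr_norm s1 mul1r ler_norml.
    have k0 : 0 <= k%:R :> R by [].
    move: l1 l2; rewrite (natrD _ k (2 * l)) (natrD _ k (2 * l.+1)) !natrM -(natr1 l) => l1 l2.
    by apply/andP; split; lra.
  apply: (le_trans (lerD b3 b4)); rewrite -mulrDr -mulrA ler_pM2l // natrD.
  have k0 : 0 <= k%:R :> R by [].
  lra.
have /andP[l1 _] := log l.
have lL : l.+1%:R <= log2 (m l) by apply: le_trans l1; rewrite ler_nat; lia.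
have L0 : 0 <= log2 (m l) by apply: le_trans lL.
rewrite normrM -intr_norm s1 mul1r ger0_norm; last first.
  by apply: mulr_ge0 => //; rewrite !divr_ge0 // ltW.
have -> : 2 ^+ k / 4 / 3 * log2 (m l) = 2 ^+ k / 12 * log2 (m l) by field.
by rewrite ler_pM2l // divr_gt0.
Qed.

Theorem theorem6p3 (R : realType) (k : nat) (hk : (3 <= k)%N) :
  let A := not_three_squares (2 ^ k - 1)%N in
  [/\ forall x : R, 2 ^+ k <= x ->
        `| (counting_fun A x)%:R - x / 6 |
          <= 2 ^+ (k - 2)%N / 3 * (log2 x - k%:R + 26),
      has_natural_density A (6^-1 : R),
      (counting_fun A x)%:R / x @[x --> +oo] --> (6^-1 : R)
    & exists m n : nat -> nat,
        [/\ increasing_seq m,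
            increasing_seq n,
            asymp_equiv
              (fun l => (counting_fun A ((m l)%:R : R))%:R - (m l)%:R / 6)
              (fun l => 2 ^+ (k - 2)%N / 3 * log2 ((m l)%:R : R))
          & asymp_equiv
              (fun l => (counting_fun A ((n l)%:R : R))%:R - (n l)%:R / 6)
              (fun l => - (2 ^+ (k - 2)%N / 3 * log2 ((n l)%:R : R)))]].
Proof.
move=> A; have dens := @counting_density R k hk; split=> //.
- by move=> x; exact: counting_log2_bound.
- exact: cvg_comp cvgr_idn dens.
exists (fun l => 2 ^ k * extremal 2 l)%N, (fun l => 2 ^ k * extremal 1 l)%N.
split; [exact: increasing_extremal | exact: increasing_extremal | |].
- rewrite (_ : (fun l => _ * log2 _) = fun l => 1%:~R * (2 ^+ (k - 2) / 3 * log2 (2 ^ k * extremal 2 l)%N%:R)).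
    apply: (asymp_extremal (s := 1)) => // l; last exact: extremal_bounds.
    by have [-> _] := rdev_extremal l; rewrite mul1r.
  by apply/funext => l; rewrite mul1r.
rewrite (_ : (fun l => - _) = fun l => (-1)%:~R * (2 ^+ (k - 2) / 3 * log2 (2 ^ k * extremal 1 l)%N%:R)).
  apply: (asymp_extremal (s := -1)) => // l; last exact: extremal_bounds.
  by have [_ ->] := rdev_extremal l; rewrite mulN1r.
by apply/funext => l; rewrite rmorphN1 mulN1r.
Qed.
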